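(* For integers $n\ge3$ and $k\ge 1$, let $a_k(B_n)$ be the number of index $k$ subgroups of the braid group $B_n$. Then - $a_k(B_n)=1$ if $k<n$ and $n>4$, or if $6<n<k<2n$; - $a_k(B_n)=n+1$ if $k=n$ and $n>6$; - $a_k(B_n)=3n+1$ if $k=2n$ and $n>6$.
   Context: $B_n$ is Artin's braid group on $n\ge3$ strings, with presentation $B_n=\langle x,y\mid y^n(yx)^{1-n},\ [y^ixy^{-i},x],\ 2\le i\le n/2\rangle$. Subgroups of index $k$ are counted as subgroups (not up to conjugacy). *)

(* Defs.v *)
From HB Require Import structures.
From mathcomp Require Import all_boot.
From mathcomp Require Import boolp classical_sets functions cardinality.

Set Implicit Arguments.
Unset Strict Implicit.
Unset Printing Implicit Defensive.

Local Open Scope classical_set_scope.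
Local Open Scope card_scope.
Local Open Scope quotient_scope.

Section Words.
Variable X : choiceType.

(* The letter (a, false) stands for the generator a, (a, true) for a^-1. *)
Definition word := seq (X * bool).

Definition wgen (a : X) : word := [:: (a, false)].
Definition winv (w : word) : word := rev [seq (l.1, ~~ l.2) | l <- w].
Definition wexp (w : word) (m : nat) : word := iter m (cat w) [::].
Definition wconj (u v : word) : word := u ++ v ++ winv u.
Definition wcomm (u v : word) : word := u ++ v ++ winv u ++ winv v.

(* The least congruence on the free monoid of words that makes a and a^-1
   mutually inverse for every generator a and that kills every relator. *)
Inductive word_eq (R : set word) : word -> word -> Prop :=
| word_eq_refl u : word_eq R u u
| word_eq_sym u v : word_eq R u v -> word_eq R v u
| word_eq_trans v u w : word_eq R u v -> word_eq R v w -> word_eq R u w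
| word_eq_cat u u' v v' :
    word_eq R u u' -> word_eq R v v' -> word_eq R (u ++ v) (u' ++ v')
| word_eq_cancel a b : word_eq R [:: (a, b); (a, ~~ b)] [::]
| word_eq_rel r : R r -> word_eq R r [::].

Lemma winv_cat u v : winv (u ++ v) = winv v ++ winv u.
Proof. by rewrite /winv map_cat rev_cat. Qed.

Lemma winvK : involutive winv.
Proof.
move=> w; rewrite /winv map_rev revK -map_comp map_id_in // => -[a b] _ /=.
by rewrite negbK.
Qed.

Variable R : set word.

Lemma word_eq_mulV w : word_eq R (w ++ winv w) [::].
Proof.
elim: w => [|[a b] w IHw]; first exact: word_eq_refl.
rewrite -cat1s winv_cat -catA [w ++ _]catA.
apply: word_eq_trans (word_eq_cancel R a b).
apply: (@word_eq_cat _ [:: (a, b)] [:: (a, b)] _ [:: (a, ~~ b)]); first exact: word_eq_refl.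
exact: (word_eq_cat IHw (word_eq_refl R _)).
Qed.

Lemma word_eq_Vmul w : word_eq R (winv w ++ w) [::].
Proof. by rewrite -{2}[w]winvK; apply: word_eq_mulV. Qed.

Lemma word_eq_inv u v : word_eq R u v -> word_eq R (winv u) (winv v).
Proof.
move=> uv; have refl w := word_eq_refl R w.
apply: (@word_eq_trans _ (winv u ++ (v ++ winv v))).
  rewrite -[X in word_eq R X _]cats0; apply: word_eq_cat => //.
  by apply: word_eq_sym; apply: word_eq_mulV.
rewrite catA; apply: (@word_eq_cat _ _ [::] _ _) => //.
apply: (@word_eq_trans _ (winv u ++ u)); last exact: word_eq_Vmul.
by apply: word_eq_cat => //; apply: word_eq_sym.
Qed.

Definition word_eqb (u v : word) : bool := `[< word_eq R u v >].

Lemma word_eqb_refl : reflexive word_eqb.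
Proof. by move=> u; apply/asboolP/word_eq_refl. Qed.

Lemma word_eqb_sym : symmetric word_eqb.
Proof. by move=> u v; apply/asboolP/asboolP; apply: word_eq_sym. Qed.

Lemma word_eqb_trans : transitive word_eqb.
Proof.
by move=> v u w /asboolP uv /asboolP vw; apply/asboolP; apply: word_eq_trans vw.
Qed.

Canonical word_equiv :=
  EquivRel word_eqb word_eqb_refl word_eqb_sym word_eqb_trans.

(* The group < X | R >. *)
Definition presented_group : Type := {eq_quot word_equiv}.

HB.instance Definition _ := Choice.on presented_group.

Definition pres_class (w : word) : presented_group :=
  \pi_({eq_quot word_equiv}) w.
Definition pres_repr (g : presented_group) : word :=
  repr (g : {eq_quot word_equiv}).

Lemma pres_reprK : cancel pres_repr pres_class.
Proof. exact: reprK. Qed.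

Lemma pres_classP u v : pres_class u = pres_class v <-> word_eq R u v.
Proof. by split=> [/eqmodP/asboolP|uv] //; apply/eqmodP/asboolP. Qed.

Lemma pres_classK w : word_eq R (pres_repr (pres_class w)) w.
Proof. by apply/pres_classP; rewrite pres_reprK. Qed.

Definition pres_one := pres_class [::].
Definition pres_mul g h := pres_class (pres_repr g ++ pres_repr h).
Definition pres_inv g := pres_class (winv (pres_repr g)).

Lemma pres_mulE u v :
  pres_mul (pres_class u) (pres_class v) = pres_class (u ++ v).
Proof. by apply/pres_classP/word_eq_cat; apply: pres_classK. Qed.

Lemma pres_invE u : pres_inv (pres_class u) = pres_class (winv u).
Proof. by apply/pres_classP/word_eq_inv/pres_classK. Qed.

Lemma pres_mulA : associative pres_mul.
Proof.
move=> g h k; rewrite -[g]pres_reprK -[h]pres_reprK -[k]pres_reprK.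
by rewrite !pres_mulE catA.
Qed.

Lemma pres_mul1 : left_id pres_one pres_mul.
Proof. by move=> g; rewrite -[g]pres_reprK pres_mulE. Qed.

Lemma pres_mulr1 : right_id pres_one pres_mul.
Proof. by move=> g; rewrite -[g]pres_reprK pres_mulE cats0. Qed.

Lemma pres_mulV : left_inverse pres_one pres_inv pres_mul.
Proof.
move=> g; rewrite -[g]pres_reprK pres_invE pres_mulE.
exact/pres_classP/word_eq_Vmul.
Qed.

Lemma pres_mulrV : right_inverse pres_one pres_inv pres_mul.
Proof.
move=> g; rewrite -[g]pres_reprK pres_invE pres_mulE.
exact/pres_classP/word_eq_mulV.
Qed.

HB.instance Definition _ := isGroup.Build presented_group
  pres_mulA pres_mul1 pres_mulr1 pres_mulV pres_mulrV.

End Words.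

(* Artin's braid group on n strings; in terms of the standard Artin generators
   s_1, ..., s_(n-1), x is s_1 and y is the product s_1 s_2 ... s_(n-1). *)
Definition braid_x : word bool := wgen false.
Definition braid_y : word bool := wgen true.

Definition braid_relators (n : nat) : set (word bool) :=
  [set wexp braid_y n ++ winv (wexp (braid_y ++ braid_x) n.-1)] `|`
  [set wcomm (wconj (wexp braid_y i) braid_x) braid_x
     | i in [set i | 2 <= i <= n./2]].

Definition braid_group (n : nat) : groupType :=
  presented_group (braid_relators n).

Definition left_coset (G : groupType) (H : set G) (g : G) : set G :=
  [set (g * h)%g | h in H].

Definition has_index (G : groupType) (H : set G) (k : nat) : Prop :=
  range (left_coset H) #= `I_k.

(* Subgroups are counted as subsets of G, not up to conjugacy. *)
Definition subgroups_of_index (G : groupType) (k : nat) : set (set G) :=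
  [set H | group_closed (mem H) /\ has_index H k].
Arguments subgroups_of_index : clear implicits.

(* Main.v *)
Require Import Defs.
From HB Require Import structures.
From mathcomp Require Import all_boot all_fingroup zify.

(** A subgroup of index k is a point stabilizer of a transitive action of B_n on
    k points, so the count comes down to the transitive actions on at most 2 n
    points. Let s 0, ..., s (n - 2) be the Artin generators. If they all act
    alike, then by powers of a single k-cycle; this cyclic action has one
    stabilizer, for every k. The heart of the proof is that any other transitive
    action on k <= 2 n points (with k < n and n > 4, or with n > 6) has a strand
    labelling, that is an equivariant map to the action of B_n on n strands
    (supp_labelling, labelling_upto_2n). As its fibres have the same size, k is
    n or 2 n.

    The product of the s i rotates them, and extends them to a family indexed by
    Z/n (artin_cyclic), in which each s i commutes with a copy of B_(n-2). This
    copy permutes the cycles of s i of a given length. When these are fewer than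
    n - 2, its generators permute them all alike by induction, and then act alike
    on the points of these cycles, because the commutator subgroup of a braid
    group on at least 5 strands is perfect (cycles_agree). Points of such cycles
    are never shared by generators that are far apart (far_disjoint): otherwise
    shared points would form an invariant set on which all the generators agree.
    If this applies to the whole support of s i, neighbouring supports overlap
    in half of their points, and the overlaps are the fibres of the labelling.
    This is always so for k < n, and proves Artin's theorem
    (artin_constant_below).

    For n > 6 and k <= 2 n it can fail only for transpositions, when s 0 has at
    least n - 2 of them, hence at most four other points. If some cycle is
    longer, the supports of the squares replace the supports (long_labelling).
    Otherwise the s i are involutions, and counting excludes fixed points
    (no_fixpoint). Then the sets where s i and s (i + 1) differ take over: they
    are unions of free orbits of a copy of S_3, at circular distance 3 or more
    they are disjoint, and a double count shows that each has 6 points and that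
    three consecutive ones meet over a strand (fpf_labelling).

    A labelled action with fibres of one or two points is determined by two bits:
    how a generator acts on the fibre over a strand that it leaves in place, and
    how the square of a generator acts on the fibre over a strand that it
    exchanges with another. Each pair of bits has a model (artin_model,
    classify_noncyclic). Without twist, the stabilizers of the n strands have
    index n; each of the three other pairs gives n subgroups of index 2 n. All of
    them are separated by explicit elements (separate_labels, separate_params),
    whence 1, n + 1 and 3 n + 1. *)

Set Implicit Arguments.
Unset Strict Implicit.
Unset Printing Implicit Defensive.

Local Open Scope group_scope.

(** * Artin relations and their rotation *)

(** The number n counts strands: only s 0, ..., s n.-2 are constrained. *)
Definition artin (G : groupType) (n : nat) (s : nat -> G) : Prop :=
  (forall i j, i.+1 < j -> j.+1 < n -> s i * s j = s j * s i) /\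
  (forall i, i.+2 < n -> s i * s i.+1 * s i = s i.+1 * s i * s i.+1).

Section ArtinGroup.
Variable G : groupType.
Implicit Types (s : nat -> G) (x y z : G).

Lemma braid_commute_eq x y : x * y * x = y * x * y -> x * y = y * x -> x = y.
Proof.
move=> brd com; apply: (mulgI (x * y)).
by rewrite brd -com.
Qed.

Lemma artin_shift n s m :
  artin (n + m) s -> artin n (fun i => s (i + m)%N).
Proof.
move=> [com brd]; split=> [i j ij jn|i i_n]; first by apply: com; lia.
by apply: brd; lia.
Qed.

(** If s 0 and s 1 coincide then s 1 commutes with s 2, and commuting elements
    that satisfy the braid relation are equal; so the equality propagates. *)
Lemma artin_constant n s : artin n s -> s 0%N = s 1%N ->
  forall i, i.+1 < n -> s i = s 0.
Proof.
move=> [com brd] s01; elim=> [//|i IHi] i_n.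
case: i IHi i_n => [//|i] IHi i_n; rewrite -IHi; last by lia.
apply/esym/braid_commute_eq; first exact: brd.
by rewrite IHi; [apply: com; lia|lia].
Qed.

Definition gprod s m n : G := \prod_(m <= i < n) s i.

Lemma gprodS s m n : m <= n -> gprod s m n.+1 = gprod s m n * s n.
Proof. by move=> ?; rewrite /gprod big_nat_recr. Qed.

Lemma gprod_commute s m n x : (forall i, m <= i < n -> s i * x = x * s i) ->
  gprod s m n * x = x * gprod s m n.
Proof.
move=> com; rewrite /gprod big_nat_cond; elim/big_rec: _ => [|i y].
  by rewrite mul1g mulg1.
by rewrite andbT => /com ci IH; rewrite -mulgA IH !mulgA ci.
Qed.

(** The rotation of the generators: s i passes every factor of the product but
    its neighbour, and there the braid relation applies. *)
Lemma artin_rotate n s i : artin n s -> i.+2 < n ->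
  gprod s 0 n.-1 * s i = s i.+1 * gprod s 0 n.-1.
Proof.
move=> [com brd] i_n.
have -> : gprod s 0 n.-1 = gprod s 0 i * (s i * s i.+1) * gprod s i.+2 n.-1.
  rewrite /gprod (@big_cat_nat _ _ _ i.+2 0 n.-1) //=; try lia.
  by rewrite !big_nat_recr //= -!mulgA.
rewrite -[_ * s i]mulgA (@gprod_commute _ i.+2); last by move=> j ij; apply/esym/com; lia.
have gi : s i.+1 * gprod s 0 i = gprod s 0 i * s i.+1.
  by apply/esym/gprod_commute => j ij; apply: com; lia.
rewrite !mulgA gi; congr (_ * _).
by rewrite -!mulgA; congr (_ * _); rewrite !mulgA brd //; lia.
Qed.

(** The rotation does not stop at the last generator: in two steps it returns
    from s n.-2 to s 0, so that the generators close up into a circle of n. *)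
Lemma artin_rotate_last n s : 2 < n -> artin n s ->
  gprod s 0 n.-1 * gprod s 0 n.-1 * s n.-2 = s 0 * (gprod s 0 n.-1 * gprod s 0 n.-1).
Proof.
move=> n2 art; set P := gprod s 0 n.-1.
have PE : P = s 0 * gprod s 1%N n.-1 by rewrite /P /gprod big_ltn //; lia.
have rot k : k <= n.-2 -> P * gprod s 0 k = gprod s 1%N k.+1 * P.
  elim: k => [|k IHk] kn; first by rewrite /gprod !big_geq // mul1g mulg1.
  rewrite gprodS // mulgA IHk; last by lia.
  rewrite -[_ * P * _]mulgA artin_rotate //; last by lia.
  by rewrite mulgA -gprodS.
rewrite {1}PE -!mulgA; congr (_ * _); rewrite mulgA.
have -> : gprod s 1%N n.-1 * P = P * gprod s 0 n.-2.
  by rewrite rot //; congr (gprod _ _ _ * _); lia.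
by rewrite -mulgA -gprodS //; congr (_ * gprod _ _ _); lia.
Qed.

Lemma artin_rotate_iter n s i k : artin n s -> i + k.+1 < n ->
  gprod s 0 n.-1 ^+ k * s i = s (i + k)%N * gprod s 0 n.-1 ^+ k.
Proof.
move=> art; elim: k => [|k IHk] ikn; first by rewrite expg0 mul1g mulg1 addn0.
rewrite expgS -mulgA IHk; last by lia.
rewrite mulgA artin_rotate //; last by lia.
by rewrite addnS mulgA.
Qed.

Lemma artin_central n s : 2 < n -> artin n s ->
  gprod s 0 n.-1 ^+ n * s 0 = s 0 * gprod s 0 n.-1 ^+ n.
Proof.
move=> n2 art; set P := gprod _ _ _.
have -> : P ^+ n = P ^+ 2 * P ^+ n.-2 by rewrite -expgnDr; congr (_ ^+ _); lia.
rewrite -mulgA artin_rotate_iter //; last by lia.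
by rewrite mulgA add0n artin_rotate_last // -!mulgA.
Qed.

End ArtinGroup.

(** The generators of B_n extended to a family indexed by Z/n, as for n points
    on a circle: conjugation by y is the rotation, and i : nat stands for its
    class modulo n. *)
Definition cyclic_braid (G : groupType) n (s : nat -> G) (y : G) : Prop :=
  [/\ forall i, s i ^ y = s i.+1,
      forall i, s (i + n)%N = s i,
      forall i j, i.+1 < j -> j.+1 < i + n -> s i * s j = s j * s i
    & forall i, s i * s i.+1 * s i = s i.+1 * s i * s i.+1].

Lemma cyclic_braid_powers (G : groupType) n (x y : G) : 2 < n ->
  x ^ y * x * x ^ y = x * x ^ y * x ->
  (forall j, 1 < j -> j.+1 < n -> x * x ^ (y ^+ j) = x ^ (y ^+ j) * x) ->
  x * y ^+ n = y ^+ n * x ->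
  cyclic_braid n (fun i => x ^ (y ^+ i)) y.
Proof.
move=> n2 brd com cen; split=> [i|i|i j ij jn|i].
- by rewrite -conjgM -expgSr.
- rewrite addnC expgnDr conjgM; congr (_ ^ _).
  by apply/conjg_fixP/commgP.
- have -> : j = (j - i + i)%N by lia.
  by rewrite expgnDr conjgM -!conjMg com //; lia.
- by rewrite expgS conjgM -!conjMg brd.
Qed.

Lemma artin_cyclic (G : groupType) n (s : nat -> G) : 2 < n -> artin n s ->
  exists2 s' : nat -> G, (forall i, i.+1 < n -> s' i = s i)
   & exists y, cyclic_braid n s' y.
Proof.
move=> n2 art; set P := gprod s 0 n.-1.
have sE i : i.+1 < n -> s 0 ^ (P^-1 ^+ i) = s i.
  move=> i_n; rewrite conjgE expVgn invgK mulgA artin_rotate_iter ?add0n //.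
  by rewrite mulgK.
have [com brd] := art.
exists (fun i => s 0 ^ (P^-1 ^+ i)) => //; exists P^-1.
apply: cyclic_braid_powers => // [|j j1 jn|].
- by rewrite -[s 0 ^ _]/(s 0 ^ (P^-1 ^+ 1%N)) sE // brd.
- by rewrite sE // com.
- by rewrite expVgn; apply: (commuteV (x := s 0)); apply/esym/artin_central.
Qed.

(** * Points on cycles of given lengths, and strand labellings *)

(** Transitivity of the group generated by s 0, ..., s n.-2; on a finite set,
    stability under the inverses is automatic. *)
Definition irreducible (T : finType) n (s : nat -> {perm T}) : Prop :=
  forall Z : {set T}, Z != set0 ->
    (forall i p, i.+1 < n -> p \in Z -> s i p \in Z) -> Z = [set: T].

(** The class of j is at distance at least 2 from that of i on the circle; its
    representative is taken in the window that follows i. *)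
Definition far n i j := (i.+1 < j) && (j.+1 < i + n).

Definition adj_swap i l := if l == i then i.+1 else if l == i.+1 then i else l.

(** An equivariant map to the action of B_n on its n strands. *)
Definition labelling (T : finType) n (s : nat -> {perm T}) (lam : T -> nat) : Prop :=
  (forall p, lam p < n) /\ (forall i p, i.+1 < n -> lam (s i p) = adj_swap i (lam p)).

Lemma periodic_mod (A : Type) (f : nat -> A) n : (forall i, f (i + n)%N = f i) ->
  forall i, f (i %% n) = f i.
Proof.
move=> per i; rewrite [in RHS](divn_eq i n).
elim: (i %/ n) => [|q IH]; first by rewrite mul0n.
by rewrite mulSn -addnA addnC per.
Qed.

Lemma card_rotating (T : finType) (y : {perm T}) (E : nat -> {set T}) :
  (forall i p, (y p \in E i.+1) = (p \in E i)) -> forall i, #|E i| = #|E 0|.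
Proof.
move=> rotEE; elim=> [//|i <-]; rewrite -[RHS](card_imset _ (@perm_inj _ y)).
apply: eq_card => p; rewrite -(permKV y p) mem_imset; last exact: perm_inj.
exact: rotEE.
Qed.

Lemma porbit_conj (T : finType) (g h : {perm T}) p :
  porbit (g ^ h) (h p) = h @: porbit g p.
Proof.
apply/setP=> q; apply/porbitP/imsetP => [[k ->]|[r /porbitP[k ->] ->]].
  exists ((g ^+ k) p); first exact: mem_porbit.
  by rewrite -conjXg permJ.
by exists k; rewrite -conjXg permJ.
Qed.

Lemma stable_perm (T : finType) (g : {perm T}) (Z : {set T}) :
  (forall p, p \in Z -> g p \in Z) -> forall p, (g p \in Z) = (p \in Z).
Proof.
move=> st p; apply/idP/idP => [|/st //].
have /eqP eZ : g @: Z == Z.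
  rewrite eqEcard card_imset ?leqnn ?andbT; last exact: perm_inj.
  by apply/subsetP => _ /imsetP[q /st ? ->].
by rewrite -{1}eZ mem_imset; last exact: perm_inj.
Qed.

Lemma porbit_agree (T : finType) (g h : {perm T}) (Z : {set T}) p :
  (forall q, q \in Z -> g q \in Z) -> (forall q, q \in Z -> g q = h q) ->
  p \in Z -> porbit g p = porbit h p.
Proof.
move=> st gh pZ.
have ghk k : (g ^+ k) p \in Z /\ (g ^+ k) p = (h ^+ k) p.
  elim: k => [|k [IH1 IH2]]; first by rewrite !expg0 !perm1.
  by rewrite !expgSr !permM -IH2 gh // -gh // st.
by apply/setP=> q; apply/porbitP/porbitP => -[k ->]; exists k; case: (ghk k).
Qed.

Lemma porbit_le1 (T : finType) (g : {perm T}) p : (#|porbit g p| <= 1) = (g p == p).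
Proof.
apply/idP/eqP => [/card_le1_eqP le1|gp].
  by apply: le1; rewrite ?porbit_id //; apply: (mem_porbit g 1%N).
rewrite -(cards1 p); apply/subset_leq_card/subsetP => q /porbitP[k ->].
by rewrite permX_fix // inE.
Qed.

Section CyclicBraid.
Variables (T : finType) (n : nat) (s : nat -> {perm T}) (y : {perm T}).
Hypothesis cyc : cyclic_braid n s y.

Lemma far_conj i j : far n i j -> s i ^ s j = s i.
Proof.
case: cyc => _ _ com _ /andP[ij ji].
by rewrite conjgE (com i j) // mulKg.
Qed.

Lemma far_conj_sym i j : far n i j -> s j ^ s i = s j.
Proof.
case: cyc => _ _ com _ /andP[ij ji].
by rewrite conjgE -(com i j) // mulKg.
Qed.

Lemma far_com i j p : far n i j -> s i (s j p) = s j (s i p).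
Proof. by case: cyc => _ _ com _ /andP[ij ji]; rewrite -!permM (com i j). Qed.

Lemma braidE i p : s i (s i.+1 (s i p)) = s i.+1 (s i (s i.+1 p)).
Proof. by case: cyc => _ _ _ brd; rewrite -!permM !mulgA brd. Qed.

Lemma braid_conj i : s i ^ (s i.+1 * s i) = s i.+1.
Proof.
by case: cyc => _ _ _ brd; rewrite conjgE [s i * _]mulgA brd mulKg.
Qed.

Lemma rotate_s i p : s i.+1 (y p) = y (s i p).
Proof. by case: cyc => rot _ _ _; rewrite -rot permJ. Qed.

Lemma period_s i : s (i + n)%N = s i. Proof. by case: cyc. Qed.

(** The condition bears only on the length of a cycle of s i, so the family
    is transported by every element that conjugates one s i to another. *)
Definition cycle_points (P : pred nat) i := [set p | P #|porbit (s i) p|].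

Lemma cycle_points_conj P g i j p : s i ^ g = s j ->
  (g p \in cycle_points P j) = (p \in cycle_points P i).
Proof.
by move=> e; rewrite !inE -e porbit_conj card_imset; last exact: perm_inj.
Qed.

Lemma cycle_points_rot P i p : (y p \in cycle_points P i.+1) = (p \in cycle_points P i).
Proof. by apply: cycle_points_conj; case: cyc. Qed.

Lemma cycle_points_per P i : cycle_points P (i + n)%N = cycle_points P i.
Proof. by rewrite /cycle_points period_s. Qed.

Lemma cycle_points_self P i p : (s i p \in cycle_points P i) = (p \in cycle_points P i).
Proof. by apply: cycle_points_conj; rewrite conjgE mulKg. Qed.

Lemma cycle_points_far P i j p : far n i j -> (s j p \in cycle_points P i) = (p \in cycle_points P i).
Proof. by move=> ij; apply: cycle_points_conj; apply: far_conj. Qed.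

Lemma cycle_points_far_sym P i j p : far n i j -> (s i p \in cycle_points P j) = (p \in cycle_points P j).
Proof. by move=> ij; apply: cycle_points_conj; apply: far_conj_sym. Qed.

Lemma cycle_points_braid P i p : (s i (s i.+1 p) \in cycle_points P i.+1) = (p \in cycle_points P i).
Proof. by rewrite -permM; apply: cycle_points_conj; apply: braid_conj. Qed.

(** The generators that commute with s i cannot be told apart on E i. *)
Definition far_agree (E : nat -> {set T}) := forall i j l p,
  p \in E i -> far n i j -> far n i l -> s j p = s l p.

Lemma far_agree_rot (E : nat -> {set T}) :
  (forall i p, (y p \in E i.+1) = (p \in E i)) ->
  (forall j p, p \in E 0 -> far n 0 j -> s j p = s 2 p) -> far_agree E.
Proof.
move=> rotEE ag; elim=> [|i IH] j l p.
  by move=> pE fj fl; rewrite (ag j) // (ag l).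
rewrite -(permKV y p) rotEE => pE fj fl.
case: j fj => [|j] fj; first by case/andP: fj.
case: l fl => [|l] fl; first by case/andP: fl.
by rewrite !rotate_s; congr (y _); apply: IH pE _ _; unfold far in *; lia.
Qed.

Hypothesis n5 : 4 < n.
Hypothesis irr : irreducible n s.
Hypothesis noncyc : s 0 <> s 1%N.

(** A point common to E i and to a far E j lies in every E l, because far
    generators have the same cycles on E i: membership travels around the
    circle. On the points of all the E l any two generators agree, so these
    points form an invariant set, hence everything, against noncyc. *)
Lemma far_disjoint P : far_agree (cycle_points P) ->
  forall i j p, far n i j -> p \in cycle_points P i -> p \notin cycle_points P j.
Proof.
move=> FA.
have H4 i j l p : p \in cycle_points P i -> far n i j -> far n i l ->
    p \in cycle_points P j -> p \in cycle_points P l.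
  move=> pi fj fl; rewrite !inE => pj.
  rewrite -(@porbit_agree _ (s j) (s l) (cycle_points P i)) // => q qi.
    by rewrite cycle_points_far.
  exact: FA qi fj fl.
have step i p : p \in cycle_points P i -> p \in cycle_points P i.+2 ->
    p \in cycle_points P i.+1 /\ p \in cycle_points P i.+3.
  move=> pi pi2; have pi3 : p \in cycle_points P i.+3.
    by apply: (H4 i i.+2) => //; unfold far; lia.
  split=> //; rewrite -cycle_points_per; apply: (H4 i.+3 (i + n)%N _ _ pi3).
  - by unfold far; lia.
  - by unfold far; lia.
  - by rewrite cycle_points_per.
have all i p : p \in cycle_points P i -> p \in cycle_points P i.+2 ->
    forall k, p \in cycle_points P (k + i).
  move=> + + k; elim: k i => [|k IH] l pl pl2 //.
  have [pl1 pl3] := step _ _ pl pl2.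
  by rewrite addSnnS; apply: IH.
move=> i j p fij pi; apply/negP => pj; apply: noncyc.
have pi2 : p \in cycle_points P i.+2.
  by apply: (H4 i j) => //; unfold far in *; lia.
pose Z := [set q | [forall k : 'I_n, q \in cycle_points P k]].
have ZE q k : q \in Z -> q \in cycle_points P k.
  rewrite inE => /forallP qZ.
  have k_n : k %% n < n by rewrite ltn_mod; lia.
  by move: (qZ (Ordinal k_n)); rewrite /cycle_points !inE /= (periodic_mod period_s).
have Zag q k : q \in Z -> s k q = s 0 q.
  move=> qZ; elim: k => [//|k <-].
  rewrite -(period_s k) -(period_s k.+1).
  by apply: (FA k.+3); rewrite ?ZE // /far; lia.
have pZ : p \in Z.
  rewrite inE; apply/forallP => k.
  have -> : cycle_points P k = cycle_points P (k + i * n - i + i).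
    rewrite /cycle_points -(periodic_mod period_s) -[in RHS](periodic_mod period_s) subnK; last by nia.
    by rewrite addnC modnMDl.
  exact: all.
have ZT : Z = [set: T].
  apply: irr => [|k q _ qZ]; first by apply/set0Pn; exists p.
  rewrite inE; apply/forallP => l.
  by rewrite (Zag q k) // -(Zag q l) // cycle_points_self ZE.
by apply/permP => q; rewrite (Zag q 1%N) // ZT inE.
Qed.

Section Blocks.
Variable B : nat -> {set T}.
Hypothesis rotB : forall i p, (y p \in B i.+1) = (p \in B i).
Hypothesis perB : forall i, B (i + n)%N = B i.
Hypothesis disB : forall j p, 0 < j -> j < n -> p \in B 0 -> p \notin B j.

Lemma blocks_disjoint i j p : i < j -> j < i + n -> p \in B i -> p \notin B j.
Proof.
elim: i j p => [|i IH] [|j] p //; first by move=> *; apply: disB; lia.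
by rewrite -(permKV y p) !rotB => *; apply: IH; lia.
Qed.

Hypothesis stepB0 : forall p, p \in B 0 -> s 0 p \in B 1%N.
Hypothesis step01 : forall p, p \in B 1%N -> s 0 p \in B 0 \/ s 0 p \in B 1%N.
Hypothesis stepBn : forall l p, 1 < l -> l < n -> p \in B l -> s 0 p \in B l.

(** The injection s 0 from B 0 to B 1 is onto by rotation invariance of the
    cardinals, so it leaves no room for s 0 to send B 1 into itself. *)
Lemma stepB1 p : p \in B 1%N -> s 0 p \in B 0.
Proof.
have imB : s 0 @: B 0 = B 1%N.
  apply/eqP; rewrite eqEcard; apply/andP; split.
    by apply/subsetP => _ /imsetP[q /stepB0 ? ->].
  by rewrite card_imset ?(card_rotating rotB 1%N) //; apply: perm_inj.
move=> pB; have [//|] := step01 pB; rewrite -imB mem_imset; last exact: perm_inj.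
by move=> p0; move: pB; rewrite (negbTE (disB _ _ p0)) //; lia.
Qed.

Lemma blocks_step i l p : i <= l -> l < i + n -> p \in B l -> s i p \in B (adj_swap i l).
Proof.
elim: i l p => [|i IH] [|l] p //; first by rewrite /adj_swap /=; auto.
  case: l => [|l] //; first by rewrite /adj_swap /= => _ _; apply: stepB1.
  by move=> _ ln; apply: stepBn.
rewrite -(permKV y p) rotate_s rotB => il ln pB.
have -> : adj_swap i.+1 l.+1 = (adj_swap i l).+1 by rewrite /adj_swap !eqSS; do 2?case: eqP.
by rewrite rotB; apply: IH => //; lia.
Qed.

(** Rotating the hypotheses on s 0 describes every s i, and the union of the
    blocks is then invariant. *)
Lemma labelling_of_blocks : B 0 != set0 -> exists lam, labelling n s lam.
Proof.
move=> /set0Pn[p0 p0B].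
have st i l p : i.+1 < n -> l < n -> p \in B l -> s i p \in B (adj_swap i l).
  move=> i_n l_n pB; have [il|li] := leqP i l; first by apply: blocks_step => //; lia.
  have -> : B (adj_swap i l) = B (adj_swap i (l + n)%N).
    have -> : adj_swap i (l + n)%N = (l + n)%N by rewrite /adj_swap; do 2?case: eqP => //; lia.
    by rewrite perB /adj_swap; do 2?case: eqP => //; lia.
  by apply: blocks_step; rewrite ?perB; lia.
have swn i l : i.+1 < n -> l < n -> adj_swap i l < n by rewrite /adj_swap; do 2?case: eqP; lia.
pose Z := [set p | [exists l : 'I_n, p \in B l]].
have ZT : Z = [set: T].
  apply: irr => [|i p i_n].
    apply/set0Pn; exists p0; rewrite inE; apply/existsP.
    by have n0 : 0 < n by [lia]; exists (Ordinal n0).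
  rewrite !inE => /existsP[l pB]; apply/existsP.
  by exists (Ordinal (swn i l i_n (ltn_ord l))); apply: st.
pose lam p := if [pick l : 'I_n | p \in B l] is Some l then l : nat else 0.
have lamP p : lam p < n /\ p \in B (lam p).
  rewrite /lam; case: pickP => [l|] //= no.
  have: p \in Z by rewrite ZT.
  by rewrite inE => /existsP[l]; rewrite no.
have lamU p l : l < n -> p \in B l -> lam p = l.
  have [l1 pB1] := lamP p => l2 pB2; apply/eqP.
  case: ltngtP => // lt; last first.
    by move: pB1; apply/contraTeq => _; apply: blocks_disjoint pB2 => //; lia.
  by move: pB2; apply/contraTeq => _; apply: blocks_disjoint pB1 => //; lia.
exists lam; split=> [p|i p i_n]; first by case: (lamP p).
have [l1 pB1] := lamP p.
by apply: lamU; [apply: swn|apply: st].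
Qed.

End Blocks.

Section Chain.
Variable P : pred nat.
Hypothesis FA : far_agree (cycle_points P).
Notation E := (cycle_points P).
Notation B := (fun l => E (l + n.-1)%N :&: E l).

Lemma card_cycle_pointsI i : #|E i :&: E i.+1| = #|E 0 :&: E 1%N|.
Proof.
apply: (@card_rotating _ y (fun i => E i :&: E i.+1)) => k p.
by rewrite !in_setI !cycle_points_rot.
Qed.

Lemma chain_block_disjoint j p : 0 < j -> j < n -> p \in B 0 -> p \notin B j.
Proof.
move=> j0 jn; rewrite !in_setI add0n => /andP[p1 p2]; apply/negP => /andP[p3 p4].
have dis := far_disjoint FA.
have [j1|j1] := eqVneq j 1%N.
  move: p4; rewrite j1 -cycle_points_per; apply/negP; apply: dis p1; unfold far; lia.
have [jn1|jn1] := eqVneq j n.-1; last first.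
  by move: p4; apply/negP; apply: dis p2; unfold far; lia.
move: p3; have -> : (j + n.-1)%N = (n.-2 + n)%N by lia.
by rewrite cycle_points_per; apply/negP; apply: dis p2; unfold far; lia.
Qed.

Lemma chain_blockE l : B l.+1 = E l :&: E l.+1.
Proof. by congr (_ :&: _); rewrite -[RHS]cycle_points_per; congr (E _); lia. Qed.

Lemma chain_blocks_sub : B 0 :|: B 1%N \subset E 0 /\ #|B 0 :|: B 1%N| = (2 * #|E 0 :&: E 1%N|)%N.
Proof.
split.
  by rewrite subUset subsetIr chain_blockE subsetIl.
rewrite cardsU chain_blockE.
have -> : (E (0 + n.-1)%N :&: E 0) :&: (E 0 :&: E 1%N) = set0.
  apply/eqP/set0Pn => -[p]; rewrite in_setI -chain_blockE => /andP[p0 p1].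
  by move: p1; apply/negP; apply: chain_block_disjoint; lia.
rewrite cards0 subn0; have -> : E (0 + n.-1)%N :&: E 0 = E n.-1 :&: E n.-1.+1.
  by congr (_ :&: _); rewrite -(cycle_points_per _ 0); congr (E _); lia.
by rewrite card_cycle_pointsI; lia.
Qed.

(** The overlaps of neighbouring sets E i are the fibres of the labelling. A
    generator preserves the E j far from it, hence all the overlaps but two;
    these two it exchanges, because s 0 s 1 maps E 0 to E 1. *)
Lemma chain_labelling : #|E 0| = (2 * #|E 0 :&: E 1%N|)%N -> E 0 != set0 ->
  exists lam, labelling n s lam.
Proof.
move=> cardE neE; have [sub cardB] := chain_blocks_sub.
have E0E : E 0 = B 0 :|: B 1%N.
  by apply/esym/eqP; rewrite eqEcard sub cardB cardE leqnn.
have part l p : p \in E l -> (p \in B l) || (p \in B l.+1).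
  elim: l p => [|l IH] p; first by rewrite {1}E0E in_setU.
  by rewrite -(permKV y p) !in_setI !cycle_points_rot -!in_setI => /IH.
have dis := far_disjoint FA.
have rotB i p : (y p \in B i.+1) = (p \in B i) by rewrite !in_setI !cycle_points_rot.
have perB i : B (i + n)%N = B i.
  by rewrite cycle_points_per; congr (_ :&: _); rewrite -[RHS]cycle_points_per; congr (E _); lia.
have stepBn l p : 1 < l -> l < n -> p \in B l -> s 0 p \in B l.
  case: l => [//|l] l1 ln; rewrite chain_blockE !in_setI => /andP[pl pl1].
  have [l_1|l_1] := eqVneq l 1%N.
    subst l; have pE2 : s 0 p \in E 2 by rewrite cycle_points_far_sym // /far; lia.
    have := part 2 (s 0 p) pE2; rewrite !chain_blockE !in_setI pE2 /= => /orP[/andP[->]//|].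
    rewrite cycle_points_far_sym; last by unfold far; lia.
    by apply/contraTT => _; apply: dis pl; unfold far; lia.
  have [ln1|ln1] := eqVneq l.+1 n.-1; last first.
    by rewrite !cycle_points_far_sym ?pl ?pl1 //; unfold far; lia.
  have plE : s 0 p \in E l by rewrite cycle_points_far_sym //; unfold far; lia.
  have := part l (s 0 p) plE; rewrite chain_blockE => /orP[|]; last by rewrite in_setI.
  case: l ln1 pl pl1 l_1 l1 ln plE => [|l] ln1 pl pl1 l_1 l1 ln plE; first by lia.
  rewrite chain_blockE in_setI => /andP[+ _].
  rewrite cycle_points_far_sym => [pl2|]; last by unfold far; lia.
  by move: pl1; apply/contraTT => _; apply: dis pl2; unfold far; lia.
have st1 p : p \in B 0 -> s 1%N p \in B 0.
  rewrite -(perB 0) add0n; case: n n5 stepBn rotB => // m m5 stB rotB'.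
  by rewrite -(permKV y p) rotate_s !rotB'; apply: stB; lia.
have stepB0 p : p \in B 0 -> s 0 p \in B 1%N.
  move=> pB; rewrite chain_blockE in_setI -[p](permKV (s 1%N)).
  have : (s 1%N)^-1 p \in B 0 by rewrite -(stable_perm st1) permKV.
  rewrite in_setI => /andP[_ qE]; rewrite cycle_points_braid qE andbT permKV cycle_points_self.
  by move: pB; rewrite in_setI => /andP[].
have step01 p : p \in B 1%N -> s 0 p \in B 0 \/ s 0 p \in B 1%N.
  move=> pB; apply/orP; rewrite -in_setU -E0E cycle_points_self.
  by move: pB; rewrite chain_blockE in_setI => /andP[].
apply: (@labelling_of_blocks B) => //; first exact: chain_block_disjoint.
have cB := card_rotating rotB 1%N.
apply: contraNneq neE => B0; rewrite E0E; apply/eqP/setP => p.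
by move: cB; rewrite B0 cards0 => /eqP; rewrite cards_eq0 => /eqP ->; rewrite set0U.
Qed.

End Chain.

(** Here E i is the support of s i. As s 0 s 1 maps the support of s 0 to that
    of s 1, a point fixed by s 1 and moved by s 0 goes into the overlap: the
    overlap is at least half of the support, and two overlaps fill it. *)
Lemma supp_labelling : far_agree (cycle_points (leq 2)) ->
  exists lam, labelling n s lam.
Proof.
move=> FA; set E := cycle_points (leq 2).
have fixE i p : p \notin E i -> s i p = p.
  by rewrite inE -ltnNge ltnS porbit_le1 => /eqP.
have E0 : E 0 != set0.
  apply/eqP => E0; apply: noncyc; apply/permP => p.
  have p1 : p \notin E 1%N by rewrite -(permKV y p) cycle_points_rot -/(E 0) E0 in_set0.
  by rewrite !fixE // E0 in_set0.
apply: (chain_labelling FA) => //; apply/eqP; rewrite eqn_leq; apply/andP; split.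
  rewrite -(cardsID (E 1%N) (E 0)) mulSn mul1n leq_add2l.
  rewrite -(card_imset _ (@perm_inj _ (s 0))); apply/subset_leq_card/subsetP.
  move=> _ /imsetP[p /setDP[p0 p1] ->].
  by rewrite in_setI cycle_points_self p0 -{1}(fixE _ _ p1) cycle_points_braid.
by have [sub <-] := chain_blocks_sub FA; apply: subset_leq_card.
Qed.
End CyclicBraid.

(** * Generators that act alike *)

Definition stable (T : finType) (A : {set T}) (g : {perm T}) :=
  forall p, p \in A -> g p \in A.

Section SubPerm.
Variables (T : finType) (A : {set T}).

Lemma sub_perm_subproof (g : {perm T}) (u : {x | x \in A}) :
  restr_perm A g (val u) \in A.
Proof. by rewrite (perm_closed _ (restr_perm_on A g)) (valP u). Qed.

(** Going through restr_perm, which is the identity unless g stabilizes A,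
    makes the restriction a total function of g. *)
Definition sub_perm_fun g u : {x | x \in A} := Sub (restr_perm A g (val u)) (sub_perm_subproof g u).

Lemma sub_perm_inj g : injective (sub_perm_fun g).
Proof. by move=> u v /(congr1 val) /perm_inj /val_inj. Qed.

Definition sub_perm g : {perm {x | x \in A}} := perm (@sub_perm_inj g).

Lemma sub_permE g u : stable A g -> val (sub_perm g u) = g (val u).
Proof.
move=> st; rewrite permE /= restr_permE ?(valP u) //.
by apply/astabsP => p; rewrite /= stable_perm.
Qed.

Lemma sub_permVE g u : stable A g -> val ((sub_perm g)^-1 u) = g^-1 (val u).
Proof.
by move=> st; apply: (@perm_inj _ g); rewrite -sub_permE // !permKV.
Qed.

Lemma artin_sub_perm n s : artin n s -> (forall i, i.+1 < n -> stable A (s i)) ->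
  artin n (fun i => sub_perm (s i)).
Proof.
move=> [com brd] st; split=> [i j ij jn|i i_n]; apply/permP => u; apply: val_inj.
  by rewrite !permM !sub_permE -?permM 1?(com i j) //; apply: st; lia.
by rewrite !permM !sub_permE -?permM ?mulgA 1?(brd i) //; apply: st; lia.
Qed.

End SubPerm.

(** Permutations that commute with g and preserve one of its cycles act on it
    as powers of g. *)
Lemma orbit_commute (T : finType) (a b g : {perm T}) p :
  commute g a -> commute g b -> a p \in porbit g p -> b p \in porbit g p ->
  a (b p) = b (a p).
Proof.
move=> ga gb /porbitP[k ak] /porbitP[l bl].
have comX (c : {perm T}) m q : commute g c -> c ((g ^+ m) q) = (g ^+ m) (c q).
  by move=> /(commute_sym) /(commuteX m) gc; rewrite -!permM gc.
by rewrite bl (comX a) // ak (comX b) // bl -!permM -!expgD addnC.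
Qed.

Lemma card_classes (T : finType) (W : {set T}) (kap : T -> {set T}) r :
  (forall p, p \in W -> [/\ p \in kap p, kap p \subset W & r <= #|kap p|]) ->
  (forall p q, p \in W -> q \in kap p -> kap q = kap p) ->
  r * #|kap @: W| <= #|W|.
Proof.
move=> kapP kapE.
have tr : trivIset (kap @: W).
  apply/trivIsetP => _ _ /imsetP[p pW ->] /imsetP[q qW ->] ne.
  apply/pred0P => z /=; apply: contraNF ne => /andP[zp zq].
  by rewrite -(kapE p z) // -(kapE q z).
apply: leq_trans (_ : #|cover (kap @: W)| <= _); last first.
  apply/subset_leq_card/bigcupsP => _ /imsetP[p pW ->].
  by case: (kapP p pW).
rewrite -(eqP tr) mulnC -sum_nat_const; apply: leq_sum => _ /imsetP[p pW ->].
by case: (kapP p pW).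
Qed.

(** The conclusion of Artin's theorem: on fewer than m points, B_m acts through
    its abelianization. *)
Definition constant_below m := forall (T : finType) (s : nat -> {perm T}),
  artin m s -> #|T| < m -> forall i, i.+1 < m -> s i = s 0.

Section Agree.
Variable m : nat.
Hypothesis TA : constant_below m.
Variables (T : finType) (s : nat -> {perm T}).
Hypothesis art : artin m s.

Lemma artin_agree_set (A : {set T}) : (forall i, i.+1 < m -> stable A (s i)) ->
  #|A| < m -> forall i p, i.+1 < m -> p \in A -> s i p = s 0 p.
Proof.
move=> st Am i p im pA.
have := TA (artin_sub_perm art st); rewrite card_sig => /(_ Am i im).
move=> /permP /(_ (Sub p pA)) /(congr1 val).
by rewrite !sub_permE //=; apply: st; lia.
Qed.

End Agree.

(** The bound is applied to the action on the set of the blocks kap p, which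
    may be much smaller than W. *)
Lemma artin_agree_blocks m (T : finType) (s : nat -> {perm T}) (W : {set T})
    (kap : T -> {set T}) :
  constant_below m -> artin m s ->
  (forall i, i.+1 < m -> stable W (s i)) ->
  (forall i p, i.+1 < m -> p \in W -> kap (s i p) = s i @: kap p) ->
  #|kap @: W| < m ->
  forall i p, i.+1 < m -> p \in W -> kap (s i p) = kap (s 0 p).
Proof.
move=> TA art st kapE lt i p im pW.
pose ip (g : {perm T}) : {perm {set T}} := perm (imset_inj (@perm_inj _ g)).
have ipM g h X : ip h (ip g X) = (g * h) @: X.
  by rewrite !permE -imset_comp; apply: eq_imset => q; rewrite permM.
have ipM3 g h k X : ip k (ip h (ip g X)) = (g * h * k) @: X.
  by rewrite ipM permE -imset_comp; apply: eq_imset => q; rewrite /= !permM.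
have art' : artin m (fun i => ip (s i)).
  case: art => com brd; split=> [a b ab bm|a am]; apply/permP => X.
    by rewrite !permM !ipM (com a b).
  by rewrite !permM !ipM3 brd.
have := artin_agree_set TA art' (A := kap @: W).
move=> /(_ _ lt i (kap p) im); rewrite !permE -!kapE //; last by lia.
apply; last exact: imset_f.
move=> a am _ /imsetP[q qW ->]; rewrite permE -kapE //.
by apply: imset_f; apply: st.
Qed.

Section AgreeFromCycles.
Variables (m : nat) (T : finType) (s : nat -> {perm T}) (W : {set T}) (g : {perm T}).
Hypothesis art : artin m s.
Hypothesis st : forall i, i.+1 < m -> stable W (s i).
Hypothesis gs : forall i, i.+1 < m -> commute g (s i).

Lemma agree_of_sub_perm : sub_perm W (s 0) = sub_perm W (s 1%N) ->
  forall i p, i.+1 < m -> p \in W -> s i p = s 0 p.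
Proof.
move=> s01 i p im pW.
have := artin_constant (artin_sub_perm art st) s01 im.
move=> /permP /(_ (Sub p pW)) /(congr1 val).
by rewrite !sub_permE //=; apply: st; lia.
Qed.

(** The generators preserve the cycles of g, so they commute on W; being
    braided, they are equal there. *)
Lemma agree_of_orbits : 2 < m ->
  (forall i p, i.+1 < m -> p \in W -> s i p \in porbit g p) ->
  forall i p, i.+1 < m -> p \in W -> s i p = s 0 p.
Proof.
move=> m2 orb; apply: agree_of_sub_perm.
have [_ brd] := artin_sub_perm art st.
apply: braid_commute_eq; first exact: brd.
apply/permP => u; apply: val_inj; rewrite !permM !sub_permE; try by apply: st; lia.
have uW := valP u.
by apply: (orbit_commute (g := g)); try (by apply: gs; lia); apply: orb; lia || exact: uW.
Qed.

(** The commutator subgroup of B_m is perfect for m > 4. Explicitly, s 3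
    commutes with s 0 and s 1, so that s 0 and s 1 divided by s 3 still satisfy
    the braid relation; these quotients preserve the cycles of g, hence commute
    on W, hence coincide. *)
Lemma agree_of_classes : 4 < m ->
  (forall i j p, i.+1 < m -> j.+1 < m -> p \in W -> s i p \in porbit g (s j p)) ->
  forall i p, i.+1 < m -> p \in W -> s i p = s 0 p.
Proof.
move=> m4 orb; apply: agree_of_sub_perm.
have [com brd] := artin_sub_perm art st.
set a := sub_perm W (s 0) in com brd *; set b := sub_perm W (s 1%N) in com brd *.
set c := sub_perm W (s 3).
have ac : commute a c by apply: com.
have bc : commute b c by apply: com.
have stW i : i.+1 < m -> stable W (s i) by apply: st.
have E3 x y z : commute x c -> commute y c ->
    (c^-1 * x) * (c^-1 * y) * (c^-1 * z) = c^-1 * c^-1 * c^-1 * (x * y * z).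
  move=> /commuteV xc /commuteV yc.
  have xd w : x * (c^-1 * w) = c^-1 * (x * w) by rewrite mulgA xc mulgA.
  have yd w : y * (c^-1 * w) = c^-1 * (y * w) by rewrite mulgA yc mulgA.
  by rewrite -!mulgA yd !xd.
suff E : c^-1 * a = c^-1 * b by apply: mulgI E.
apply: braid_commute_eq.
  by rewrite !E3 //; congr (_ * _); apply: brd; lia.
have near i u : i.+1 < m -> val ((c^-1 * sub_perm W (s i)) u) \in porbit g (val u).
  move=> im; rewrite permM sub_permE; last exact: st.
  rewrite -{2}(permKV c u) [val (c _)]sub_permE; last by apply: st; lia.
  by apply: orb; [| lia | exact: valP].
have cE i u : i.+1 < m -> val ((c^-1 * sub_perm W (s i)) u) = ((s 3)^-1 * s i) (val u).
  by move=> im; rewrite !permM sub_permE ?sub_permVE //; apply: st; lia.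
have gE i : i.+1 < m -> commute g ((s 3)^-1 * s i).
  by move=> im; apply: commuteM; [apply: commuteV|]; apply: gs; lia.
apply/permP => u; apply: val_inj; rewrite (permM (c^-1 * a)) (permM (c^-1 * b)) !cE; try lia.
by apply/esym/(orbit_commute (g := g)); rewrite -?cE; try apply: gE; try apply: near; lia.
Qed.

End AgreeFromCycles.

(** * Artin's theorem on fewer than n points *)

Lemma labelling_card (T : finType) n (s : nat -> {perm T}) lam : 0 < n ->
  irreducible n s -> labelling n s lam -> 0 < #|T| ->
  #|T| = (n * #|[set p | lam p == 0]|)%N.
Proof.
move=> n0 irr [lamn lams] T0.
have fib l : l < n -> #|[set p | lam p == l]| = #|[set p | lam p == 0]|.
  elim: l => [//|l IH] ln; rewrite -IH; last by lia.
  rewrite -[RHS](card_imset _ (@perm_inj _ (s l))); apply: eq_card => p.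
  rewrite -(permKV (s l) p) mem_imset; last exact: perm_inj.
  rewrite !inE lams // /adj_swap.
  move: (lam _) => a.
  by case: (a =P l) => e1; case: (a =P l.+1) => e2; lia.
transitivity (\sum_(l < n) #|[set p | lam p == 0]|)%N; last first.
  by rewrite sum_nat_const card_ord.
have -> : #|T| = (\sum_(p : T) 1)%N by rewrite sum1_card.
rewrite (partition_big (fun p => Ordinal (lamn p)) predT) //=.
apply: eq_bigr => l _; rewrite sum1_card -(fib l) //; apply: eq_card => p.
by rewrite !inE unfold_in.
Qed.

(** Fixed point free involutions of four points are double transpositions, and
    these form a four-group. *)
Lemma fpf_commute4 (T : finType) (g h : {perm T}) : #|T| <= 4 ->
  (forall p, g (g p) = p) -> (forall p, h (h p) = p) ->
  (forall p, g p != p) -> (forall p, h p != p) -> g * h = h * g.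
Proof.
move=> T4 g2 h2 g1 h1; apply/permP => p; rewrite !permM.
have [e|ne] := eqVneq (g p) (h p); first by rewrite e h2 -e g2.
apply/eqP; apply: contraLR T4 => ne2; rewrite -ltnNge.
have : uniq [:: p; g p; h p; h (g p); g (h p)].
  have a1 : p != h (g p) by apply: contra_neq ne => e; rewrite {2}e h2.
  have a2 : p != g (h p) by apply: contra_neq ne => e; rewrite {1}e g2.
  rewrite /= !inE !negb_or a1 a2 ne ne2 (eq_sym p) g1 (eq_sym p) h1.
  rewrite (eq_sym (g p)) h1 (inj_eq perm_inj) (eq_sym p) h1.
  by rewrite (inj_eq perm_inj) (eq_sym p) g1 eq_sym g1.
by move=> /card_uniqP /= <-; apply: max_card.
Qed.

Section FarCycles.
Variables (T : finType) (n : nat) (s : nat -> {perm T}) (y : {perm T}).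
Hypothesis cyc : cyclic_braid n s y.
Hypothesis n5 : 4 < n.

Lemma cyclic_artin : artin n s.
Proof.
by case: cyc => _ _ com brd; split=> [i j ij jn|i _]; [apply: com; lia|].
Qed.

Lemma far_artin : artin n.-2 (fun i => s (i + 2)%N).
Proof.
have e : (n.-2 + 2)%N = n by lia.
by apply: (@artin_shift _ n.-2 s 2); rewrite e; apply: cyclic_artin.
Qed.

Notation E P i := (cycle_points s P i).

(** The generators far from s 0 form a copy of B_(n-2) that permutes the cycles
    of s 0 of length r. If these are fewer than n - 2, the copy permutes them
    through its abelianization, and agree_of_classes descends from the cycles
    to their points. *)
Lemma cycles_agree r : 6 < n -> constant_below n.-2 ->
  #|E (pred1 r) 0| < r * n.-2 ->
  forall j p, p \in E (pred1 r) 0 -> far n 0 j -> s j p = s 2 p.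
Proof.
move=> n7 TA lt j p pE fj.
pose W := E (pred1 r) 0.
have st i : i.+1 < n.-2 -> stable W (s (i + 2)%N).
  by move=> im q qW; rewrite (cycle_points_far cyc _ _ (_ : far n 0 _)) // /far; lia.
have gs i : i.+1 < n.-2 -> commute (s 0) (s (i + 2)%N).
  by case: cyc => _ _ com _ im; apply: com; lia.
have kapE i q : i.+1 < n.-2 -> q \in W ->
    porbit (s 0) (s (i + 2)%N q) = s (i + 2)%N @: porbit (s 0) q.
  by move=> im _; rewrite -porbit_conj conjgE gs // mulKg.
have kcard : #|porbit (s 0) @: W| < n.-2.
  have r0 : 0 < r by lia.
  rewrite -(ltn_pmul2l r0); apply: leq_ltn_trans lt.
  apply: card_classes => [q|q t qW qt].
    rewrite inE => /eqP qr; rewrite porbit_id qr leqnn; split=> //.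
    apply/subsetP => t tq; rewrite inE /= -qr.
    by move: tq; rewrite -eq_porbit_mem => /eqP ->.
  by apply/eqP; rewrite eq_porbit_mem.
have blk := artin_agree_blocks TA far_artin st kapE kcard.
have orb a b q : a.+1 < n.-2 -> b.+1 < n.-2 -> q \in W ->
    s (a + 2)%N q \in porbit (s 0) (s (b + 2)%N q).
  by move=> am bm qW; rewrite -eq_porbit_mem blk // [eqbRHS]blk.
have := agree_of_classes far_artin st gs _ orb.
case: j fj => [|[|j]] fj; try by case/andP: fj.
move=> /(_ _ j p) H; rewrite -addn2 H //; unfold far in *; lia.
Qed.

Lemma cycles_far_agree (P : pred nat) : 6 < n -> constant_below n.-2 ->
  (forall r, P r -> #|E (pred1 r) 0| < r * n.-2) -> far_agree n s (cycle_points s P).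
Proof.
move=> n7 TA lt; apply: (far_agree_rot cyc) => [i p|j p].
  exact: (cycle_points_rot cyc).
rewrite inE => /lt /cycles_agree ag fj; apply: ag => //.
by rewrite inE /=.
Qed.

End FarCycles.

(** Restriction to the orbit of a point where s 0 and s 1 differ. *)
Lemma artin_reduce (T : finType) n (s : nat -> {perm T}) : 2 < n ->
  artin n s -> s 0 <> s 1%N ->
  exists (T' : finType) (s' : nat -> {perm T'}) y',
   [/\ #|T'| <= #|T|, cyclic_braid n s' y', irreducible n s' & s' 0 <> s' 1%N].
Proof.
move=> n2 art ne.
have [p np] : exists p, s 0 p != s 1%N p.
  apply/existsP; apply: contra_notT ne => /existsPn eq.
  by apply/permP => p; apply/eqP; rewrite -[_ == _]negbK eq.
pose G := <<[set s (i : nat) | i : 'I_n.-1]>>.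
have sG i : i.+1 < n -> s i \in G.
  move=> i_n; apply: mem_gen; have i_n' : i < n.-1 by lia.
  by apply/imsetP; exists (Ordinal i_n').
pose A := orbit 'P G p.
have st i : i.+1 < n -> stable A (s i).
  by move=> i_n q; rewrite /A => /orbit_eqP <-; apply: (mem_orbit 'P q (sG i i_n)).
have [s' s'E [y cyc]] := artin_cyclic n2 (artin_sub_perm art st).
exists {x | x \in A}, s', y; split=> //.
- by rewrite card_sig max_card.
- move=> Z /set0Pn[u uZ] stZ; apply/setP => v; rewrite [RHS]inE.
  pose Z' := [set val z | z in Z].
  have actZ : [acts G, on Z' | 'P].
    rewrite gen_subG; apply/subsetP => _ /imsetP[i _ ->].
    have i_n : i.+1 < n by have := ltn_ord i; lia.
    apply/astabsP => q; rewrite /= apermE; apply: stable_perm q => _ /imsetP[z zZ ->].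
    by rewrite -sub_permE; [rewrite -s'E // imset_f // stZ|exact: st].
  have : val v \in Z'.
    have uZ' : val u \in Z' by apply: imset_f.
    have := acts_sub_orbit (val u) actZ; rewrite uZ' => /subsetP; apply.
    have := valP u; rewrite {1}/A => /orbit_eqP ->; exact: (valP v).
  by move=> /imsetP[z zZ /val_inj ->].
- have pA : p \in A by apply: orbit_refl.
  rewrite !s'E; [|lia|lia] => /permP /(_ (Sub p pA)) /(congr1 val).
  by rewrite !sub_permE /=; [move/eqP; apply/negP|apply: st; lia|apply: st; lia].
Qed.

Section BelowN.
Variables (T : finType) (n : nat) (s : nat -> {perm T}) (y : {perm T}).
Hypothesis cyc : cyclic_braid n s y.
Hypothesis n5 : 4 < n.
Hypothesis irr : irreducible n s.
Hypothesis noncyc : s 0 <> s 1%N.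

Notation E P i := (cycle_points s P i).

Lemma noncyclic_card_gt0 : 0 < #|T|.
Proof.
rewrite lt0n; apply: contra_not_neq noncyc => T0; apply/permP => p.
by have := max_card (pred1 p); rewrite T0 card1.
Qed.

Lemma labelling_dvd lam : labelling n s lam -> exists2 b, 0 < b & #|T| = (n * b)%N.
Proof.
move=> labl; have n0 : 0 < n by lia.
have e := labelling_card n0 irr labl noncyclic_card_gt0.
by exists #|[set p | lam p == 0]| => //; have := noncyclic_card_gt0; rewrite e; lia.
Qed.

(** For n = 5 or 6, B_(n-2) has no perfect commutator subgroup to rely on. But
    if a far generator moved a cycle of s 0, there would be two cycles of the
    same length at least 2 among at most five points, that is two
    transpositions and at most one fixed point. A single fixed point is ruled
    out by far_disjoint; without it, s 0 and s 1 are fixed point free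
    involutions of four points, so they commute. *)
Lemma small_cycles_preserved : n < 7 -> #|T| < n ->
  forall j p, p \in E (leq 2) 0 -> far n 0 j -> s j p \in porbit (s 0) p.
Proof.
move=> n7 Tn j p; rewrite inE => X2 fj; rewrite -eq_porbit_mem.
have pj : porbit (s 0) (s j p) = s j @: porbit (s 0) p.
  by rewrite -porbit_conj (far_conj cyc).
apply: contraT => ne; case: noncyc.
set X := porbit (s 0) p in X2 ne pj; set Y := porbit (s 0) (s j p) in ne pj.
have dis : [disjoint X & Y].
  apply/pred0P => z /=; apply: contraNF ne => /andP[].
  by rewrite /X /Y -!eq_porbit_mem => /eqP -> /eqP ->.
have cY : #|Y| = #|X| by rewrite pj card_imset //; apply: perm_inj.
have cXY : #|X :|: Y| = (#|X| + #|X|)%N.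
  by rewrite cardsU disjoint_setI0 // cards0 subn0 cY.
have le5 : #|X :|: Y| + #|~: (X :|: Y)| <= 5 by rewrite cardsC; lia.
have cX : #|X| = 2 by move: le5; rewrite cXY; lia.
have le1 : #|~: (X :|: Y)| <= 1 by move: le5; rewrite cXY; lia.
have cyc2 z : z \in X :|: Y -> #|porbit (s 0) z| = 2.
  by rewrite in_setU /X /Y -!eq_porbit_mem => /orP[] /eqP ->; rewrite -/X -/Y ?cY.
pose F := cycle_points s (pred1 1%N).
have FC z : z \in F 0 -> z \in ~: (X :|: Y).
  by rewrite !inE -in_setU => /eqP z1; apply/negP => /cyc2; rewrite z1.
have FA : far_agree n s F.
  apply: (far_agree_rot cyc) => [i q|i q qF fi]; first exact: (cycle_points_rot cyc).
  apply: (card_le1_eqP le1); apply: FC; rewrite (cycle_points_far cyc) // /far; lia.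
have F0 z : z \notin F 0.
  apply/negP => zF; have f2 : far n 0 2 by unfold far; lia.
  have := far_disjoint cyc n5 irr noncyc FA f2 zF; apply/negP/negPn.
  have z2 : s 2 z = z by apply: (card_le1_eqP le1); apply: FC => //; rewrite (cycle_points_far cyc).
  by rewrite inE /= eqn_leq porbit_le1 z2 eqxx lt0n card_porbit_neq0.
have allXY z : z \in X :|: Y.
  apply: contraT => zC; have := F0 z; rewrite inE /= eqn_leq lt0n card_porbit_neq0 andbT.
  move/negP; case; apply: leq_trans le1; apply/subset_leq_card/subsetP => q qz.
  rewrite inE; apply: contra zC; rewrite !in_setU /X /Y -!eq_porbit_mem.
  by move: qz; rewrite -eq_porbit_mem => /eqP ->.
have T4 : #|T| <= 4.
  by rewrite -cardsT -[X in _ <= X]/(2 + 2)%N -cX -cXY; apply/subset_leq_card/subsetP.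
have s0fix z : s 0 z != z by rewrite -porbit_le1 cyc2.
have s0inv z : s 0 (s 0 z) = z.
  by have := iter_porbit (s 0) z; rewrite cyc2.
have s1fix z : s 1%N z != z by rewrite -(permKV y z) (rotate_s cyc) (inj_eq perm_inj).
have s1inv z : s 1%N (s 1%N z) = z by rewrite -(permKV y z) !(rotate_s cyc) s0inv.
apply: braid_commute_eq; first by case: cyc.
exact: fpf_commute4.
Qed.

Lemma small_agree : n < 7 -> #|T| < n -> far_agree n s (cycle_points s (leq 2)).
Proof.
move=> n7 Tn; apply: (far_agree_rot cyc) => [i q|j p pE fj].
  exact: (cycle_points_rot cyc).
have := @agree_of_orbits n.-2 T (fun i => s (i + 2)%N) (E (leq 2) 0) (s 0)
  (far_artin cyc n5).
case: j fj => [|[|j]] fj; try by case/andP: fj.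
move=> H; rewrite -addn2; apply: (H _ _ _ _ j p) => //; try (by unfold far in *; lia); clear H.
- by move=> i im q qE; rewrite (cycle_points_far cyc) // /far; lia.
- by move=> i im; case: cyc => _ _ com _; apply: com; lia.
- by move=> i q im qE; apply: small_cycles_preserved => //; unfold far; lia.
Qed.

Lemma large_agree : 6 < n -> constant_below n.-2 -> #|T| < n -> far_agree n s (cycle_points s (leq 2)).
Proof.
move=> n7 TA Tn; apply: (cycles_far_agree cyc) => // r r2.
by apply: leq_ltn_trans (max_card _) _; nia.
Qed.

End BelowN.

(** Artin's theorem. Below n points there are too few cycles for the far
    generators to act on them otherwise than all alike, so a non-cyclic orbit
    would be labelled by the strands, and have at least n points. *)
Theorem artin_constant_below n : 4 < n -> constant_below n.
Proof.
elim/ltn_ind: n => n IH n5 T s art Tn i i_n.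
have [s01|/eqP ne] := eqVneq (s 0) (s 1%N); first exact: (artin_constant art).
have n2 : 2 < n by lia.
have [T' [s' [y [T'T cyc irr noncyc]]]] := artin_reduce n2 art ne.
have T'n : #|T'| < n by lia.
have FA : far_agree n s' (cycle_points s' (leq 2)).
  have [n7|n7] := ltnP n 7; first exact: (small_agree cyc).
  by apply: (large_agree cyc) => //; apply: IH; lia.
have [lam /(labelling_dvd n5 irr noncyc)[b b0 e]] := supp_labelling cyc n5 irr noncyc FA.
by move: T'n; rewrite e; nia.
Qed.

(** * At most 2n points: reduction to fixed point free involutions *)

Lemma card_disjoint_family (T : finType) n d (D : nat -> {set T}) :
  (forall i, i < n -> #|D i| = d) ->
  (forall i j p, i < j -> j < n -> p \in D i -> p \notin D j) ->
  #|\bigcup_(i < n) D i| = (n * d)%N.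
Proof.
move=> cD dis; rewrite -sum1_card partition_disjoint_bigcup => [|i j ij].
  rewrite -[in RHS](card_ord n) -sum_nat_const; apply: eq_bigr => i _.
  by rewrite sum1_card cD.
apply/pred0P => p /=; apply/negP => /andP[pi pj].
case: (ltngtP i j) => [lt|lt|e].
- by move: pj; apply/negP; apply: dis pi.
- by move: pi; apply/negP; apply: dis pj.
- by move: ij; rewrite (val_inj e) eqxx.
Qed.

Section UpTo2n.
Variables (T : finType) (n : nat) (s : nat -> {perm T}) (y : {perm T}).
Hypothesis cyc : cyclic_braid n s y.
Hypothesis n7 : 6 < n.
Hypothesis irr : irreducible n s.
Hypothesis noncyc : s 0 <> s 1%N.
Hypothesis T2n : #|T| <= 2 * n.

Lemma n_gt4 : 4 < n. Proof. by lia. Qed.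
Local Notation n5 := n_gt4.

Lemma constant_below_minus2 : constant_below n.-2.
Proof. by apply: artin_constant_below; lia. Qed.

Lemma noncyclic_adjacent i : s i <> s i.+1.
Proof.
elim: i => [//|i IH] e; apply: IH; apply/permP => p.
by apply: (@perm_inj _ y); rewrite -!(rotate_s cyc) e.
Qed.

Lemma cycle_points_disj (P Q : pred nat) : (forall r, P r -> ~~ Q r) ->
  #|cycle_points s P 0| + #|cycle_points s Q 0| = #|cycle_points s (predU P Q) 0|.
Proof.
move=> PQ; have -> : cycle_points s (predU P Q) 0 = cycle_points s P 0 :|: cycle_points s Q 0.
  by apply/setP => p; rewrite !inE.
rewrite cardsU; have -> : cycle_points s P 0 :&: cycle_points s Q 0 = set0; last by rewrite cards0 subn0.
by apply/setP => p; rewrite !inE; apply/negP => /andP[/PQ/negP].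
Qed.

Section ManyTranspositions.
Hypothesis many : 2 * n.-2 <= #|cycle_points s (pred1 2) 0|.

Lemma card_outside_transpositions : #|cycle_points s (pred1 1%N) 0| + #|cycle_points s (leq 3) 0| <= 4.
Proof.
have d1 r : pred1 1%N r -> ~~ (3 <= r) by move=> /eqP ->.
have d2 r : pred1 2 r -> ~~ predU (pred1 1%N) (leq 3) r by move=> /eqP ->.
have := cycle_points_disj d2; rewrite -(cycle_points_disj d1) => e.
have le : #|cycle_points s (predU (pred1 2) (predU (pred1 1%N) (leq 3))) 0| <= 2 * n.
  by apply: leq_trans (max_card _) T2n.
by rewrite -e in le; move: many; lia.
Qed.

Lemma far_agree_long : far_agree n s (cycle_points s (leq 3)).
Proof.
apply: (cycles_far_agree cyc n5 n7 constant_below_minus2) => r r3.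
by apply: leq_ltn_trans (max_card _) _; nia.
Qed.

Lemma far_agree_fix : far_agree n s (cycle_points s (pred1 1%N)).
Proof.
apply: (cycles_far_agree cyc n5 n7 constant_below_minus2) => r /eqP ->.
by have := card_outside_transpositions; lia.
Qed.

Local Notation E := (cycle_points s (leq 3)).

(** The points on cycles of s i of length at least 3 are at most four, so the
    far generators agree on them. *)
Lemma long_labelling : E 0 != set0 -> exists lam, labelling n s lam.
Proof.
move=> E0.
have FA := far_agree_long; have dis := far_disjoint cyc n5 irr noncyc FA.
have [sub2b card2b] := chain_blocks_sub cyc n5 irr noncyc FA.
have le2b := subset_leq_card sub2b; rewrite card2b in le2b.
have cE := card_rotating (cycle_points_rot cyc (leq 3)).
have cD i : i < n -> #|E i :\: E i.+1| = #|E 0| - #|E 0 :&: E 1%N|.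
  by move=> _; rewrite cardsD cE (card_cycle_pointsI cyc).
have dD i j p : i < j -> j < n -> p \in E i :\: E i.+1 -> p \notin E j :\: E j.+1.
  rewrite !in_setD => ij jn /andP[p1 p2]; apply/negP => /andP[p3 p4].
  have [e|ne] := eqVneq j i.+1; first by rewrite -e p4 in p1.
  have [fij|nfij] := boolP (far n i j).
    by move: p4; apply/negP; apply: dis p2.
  (* The pair that is left is i = 0 and j = n - 1, adjacent on the circle. *)
  move: p3; have -> : j.+1 = (i + n)%N by unfold far in nfij; lia.
  by rewrite (cycle_points_per cyc) p2.
have cov := card_disjoint_family cD dD.
have le1 := max_card (mem (\bigcup_(i < n) (E i :\: E i.+1))).
rewrite cov in le1.
have a3 : 2 < #|E 0|.
  case/set0Pn: E0 => p pE; have := pE; rewrite inE => /leq_trans; apply.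
  apply/subset_leq_card/subsetP => q; rewrite -eq_porbit_mem => /eqP qp.
  by move: pE; rewrite !inE qp.
have a4 := card_outside_transpositions.
(* The sets E i :\: E i.+1 are pairwise disjoint. *)
have ab : #|E 0| - #|E 0 :&: E 1%N| <= 2.
  by rewrite -(@leq_pmul2l n); lia.
have [a_4|a_3] := eqVneq #|E 0| (2 * #|E 0 :&: E 1%N|)%N.
  exact: (chain_labelling cyc n5 irr noncyc FA).
(* The remaining case: E i has 3 points, and so T has 2 n points, of which s 0
   fixes at most one; but it fixes the overlaps of E 2, E 3 and of E 3, E 4. *)
have b1 : #|E 0 :&: E 1%N| = 1%N by lia.
have fixcard : #|cycle_points s (pred1 1%N) 0| <= 1 by lia.
have fiber_pt i : far n 0 i -> far n 0 i.+1 ->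
    exists2 p, p \in E i :&: E i.+1 & p \in cycle_points s (pred1 1%N) 0.
  move=> fi fi1; have := card_cycle_pointsI cyc (leq 3) i; rewrite b1 => /eqP/cards1P[p pE].
  have pI : p \in E i :&: E i.+1 by rewrite pE set11.
  exists p => //; rewrite inE /= eqn_leq porbit_le1 lt0n card_porbit_neq0 andbT.
  rewrite -in_set1 -pE in_setI; move: pI; rewrite in_setI.
  by rewrite !(cycle_points_far_sym cyc).
have [||p pE pF] := fiber_pt 2; try by unfold far; lia.
have [||q qE qF] := fiber_pt 3; try by unfold far; lia.
have pq : p = q by apply: (card_le1_eqP fixcard).
move: pE qE; rewrite -pq !in_setI => /andP[p2 _] /andP[_ p4].
by move: p4; rewrite (negbTE (dis 2 4 p _ p2)) //; unfold far; lia.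
Qed.

Hypothesis short : cycle_points s (leq 3) 0 = set0.

Lemma involution i p : s i (s i p) = p.
Proof.
have inv0 q : s 0 (s 0 q) = q.
  have : q \notin cycle_points s (leq 3) 0 by rewrite short inE.
  rewrite inE -ltnNge => lt3; have := iter_porbit (s 0) q.
  have := card_porbit_neq0 (s 0) q.
  by case: #|_| lt3 => [|[|[|k]]] //= _ _ e; rewrite !e.
elim: i p => [//|i IH] p.
by rewrite -(permKV y p) !(rotate_s cyc) IH.
Qed.

Notation F := (cycle_points s (pred1 1%N)).

Lemma fixE i p : (p \in F i) = (s i p == p).
Proof. by rewrite inE /= eqn_leq porbit_le1 lt0n card_porbit_neq0 andbT. Qed.

(** A common fixed point of s 0 and s 1, with its common image under the other
    generators, would form an invariant set. *)
Lemma fix_adjacent i p : p \in F i -> p \notin F i.+1.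
Proof.
elim: i p => [|i IH] p; last by rewrite -(permKV y p) !(cycle_points_rot cyc); apply: IH.
move=> p0; apply/negP => p1.
have FA := far_agree_fix.
pose q := s 2 p; have qE j : far n 0 j -> s j p = q.
  by move=> fj; apply: (FA 0) => //; unfold far; lia.
have f2 : far n 0 2 by unfold far; lia.
have f3 : far n 0 3 by unfold far; lia.
have f13 : far n 1 3 by unfold far; lia.
have q0 : s 0 q = q.
  by rewrite /q (far_com cyc) //; congr (s 2 _); apply/eqP; rewrite -fixE.
have q1 : s 1%N q = q.
  rewrite -(qE 3) // (far_com cyc) //; congr (s 3 _); apply/eqP; by rewrite -fixE.
have ZT : [set p; q] = [set: T].
  apply: irr => [|i z i_n]; first by apply/set0Pn; exists p; rewrite !inE eqxx.
  have [i0|i0] := eqVneq i 0.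
    move: p0; rewrite fixE i0 => /eqP p0.
    by rewrite !inE => /orP[] /eqP ->; rewrite ?p0 ?q0 eqxx ?orbT.
  have [i1|i1] := eqVneq i 1%N.
    move: p1; rewrite fixE i1 => /eqP p1.
    by rewrite !inE => /orP[] /eqP ->; rewrite ?p1 ?q1 eqxx ?orbT.
  have qi := qE i; rewrite !inE => /orP[] /eqP ->.
    by rewrite qi ?eqxx ?orbT // /far; lia.
  by rewrite -qi ?involution ?eqxx // /far; lia.
apply: (@noncyclic_adjacent 2); apply/permP => z.
have : z \in [set p; q] by rewrite ZT inE.
rewrite !inE => /orP[] /eqP ->; first by rewrite [RHS]qE.
by rewrite -{2}(qE 3) // /q !involution.
Qed.

(** The sets of fixed points of the s i are pairwise disjoint, and have at least
    two points since s 2 moves any fixed point of s 0 to another one. With at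
    most 2 n points in all, they cover T; but the image by s 1 of a fixed
    point of s 0 can lie in none of them. *)
Lemma no_fixpoint p : s 0 p != p.
Proof.
rewrite -fixE; apply/negP => pF.
have FA := far_agree_fix; have dis := far_disjoint cyc n5 irr noncyc FA.
have disB j q : 0 < j -> j < n -> q \in F 0 -> q \notin F j.
  move=> j0 jn q0; have [->|j1] := eqVneq j 1%N; first exact: fix_adjacent.
  have [jn1|jn1] := eqVneq j n.-1; last by apply: dis q0; unfold far; lia.
  apply/negP => /fix_adjacent; rewrite jn1 prednK; last by lia.
  by rewrite -[n]add0n (cycle_points_per cyc) q0.
have rotF i q : (y q \in F i.+1) = (q \in F i) by apply: (cycle_points_rot cyc).
have disF := blocks_disjoint n5 rotF disB.
have cF := card_rotating rotF.
have f2 : far n 0 2 by unfold far; lia.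
have F2 : 2 <= #|F 0|.
  have ne : s 2 p != p by rewrite -fixE disB //; lia.
  have := cards2 (s 2 p) p; rewrite ne => <-.
  apply/subset_leq_card/subsetP => q; rewrite !inE => /orP[] /eqP ->.
    by have := cycle_points_far cyc (pred1 1%N) p f2; rewrite pF inE.
  by move: pF; rewrite inE.
have cov : #|\bigcup_(i < n) F i| = (n * #|F 0|)%N.
  by apply: card_disjoint_family => // i j q ij jn; apply: disF; lia.
have covT : \bigcup_(i < n) F i = [set: T].
  by apply/eqP; rewrite eqEcard subsetT cardsT cov; nia.
have : s 1%N p \in \bigcup_(i < n) F i by rewrite covT.
case/bigcupP => -[i i_n] _ /= wi.
have b1 : s 0 (s 1%N p) \in F 1%N by rewrite (cycle_points_braid cyc).
have [i1|i1] := eqVneq i 1%N.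
  move: wi; rewrite i1 cycle_points_self; apply/negP; apply: disB => //; lia.
have [in1|in1] := eqVneq i n.-1.
  have f1n : far n 1 n.-1 by unfold far; lia.
  move: wi; rewrite in1 (cycle_points_far_sym cyc) //; apply/negP; apply: disB => //; lia.
have bi : s 0 (s 1%N p) \in F i.
  have [i0|i0] := eqVneq i 0; first by move: wi; rewrite i0 cycle_points_self.
  have f0i : far n 0 i by unfold far; lia.
  by rewrite (cycle_points_far_sym cyc _ _ f0i).
have [lt|lt] := ltnP i 1.
  by move: b1; apply/negP; apply: disF bi; lia.
by move: bi; apply/negP; apply: disF b1; lia.
Qed.

End ManyTranspositions.

(** Either s 0 has fewer than n - 2 transpositions, and the far generators
    agree on its whole support, or at most four points lie outside them. *)
Lemma labelling_or_fpf : (exists lam, labelling n s lam) \/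
  ((forall i p, s i (s i p) = p) /\ (forall i p, s i p != p)).
Proof.
have [lt2|many] := ltnP #|cycle_points s (pred1 2) 0| (2 * n.-2).
  left; apply: (supp_labelling cyc n5 irr noncyc); apply: (cycles_far_agree cyc n5 n7 constant_below_minus2) => r r2.
  have [-> //|ne2] := eqVneq r 2.
  by apply: leq_ltn_trans (max_card _) _; nia.
have [short|long] := eqVneq (cycle_points s (leq 3) 0) set0; last first.
  by left; apply: long_labelling.
right; split=> [i p|]; first exact: involution.
elim=> [|i IH] p; first exact: no_fixpoint.
by rewrite -(permKV y p) (rotate_s cyc) (inj_eq perm_inj).
Qed.

End UpTo2n.

(** * Fixed point free involutions *)

Section InvolutionGroup.
Variable G : groupType.
Implicit Types x y z : G.

Lemma braid_involutions_cube x y : x * x = 1 -> y * y = 1 ->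
  x * y * x = y * x * y -> (x * y) ^+ 3 = 1.
Proof.
move=> x2 y2 brd; rewrite !expgS expg0 mulg1 !mulgA brd.
by rewrite -(mulgA _ y y) y2 mulg1 -(mulgA _ x x) x2 mulg1.
Qed.

(** The products z x and z y have order dividing 3 and commute, so the same
    holds for their quotient x y, which is also an involution. *)
Lemma braid_involutions_eq x y z : x * x = 1 -> y * y = 1 -> z * z = 1 ->
  z * x * z = x * z * x -> z * y * z = y * z * y -> x * y = y * x ->
  commute (z * x) (z * y) -> x = y.
Proof.
move=> x2 y2 z2 zx zy xy com.
have d2 : (x * y) ^+ 2 = 1 by rewrite expgMn // !expg2 x2 y2 mulg1.
have xV : x^-1 = x by apply: mulg1_eq.
have zV : z^-1 = z by apply: mulg1_eq.
have yV : y^-1 = y by apply: mulg1_eq.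
have dE : (z * x)^-1 * (z * y) = x * y by rewrite invMg xV zV -mulgA (mulgA z) z2 mul1g.
have d3 : (x * y) ^+ 3 = 1.
  rewrite -dE expgMn; last by apply: commute_sym; apply: commuteV; apply: commute_sym.
  by rewrite expVgn !braid_involutions_cube // invg1 mulg1.
have : x * y = 1 by rewrite -d3 expgS d2 mulg1.
by move/mulg1_eq; rewrite xV.
Qed.

End InvolutionGroup.

Lemma perm_cube (T : finType) (v : {perm T}) p : (v ^+ 3) p = v (v (v p)).
Proof. by rewrite !expgS expg0 mulg1 !permM. Qed.

Section Hexagons.
Variables (T : finType) (n : nat) (s : nat -> {perm T}) (y : {perm T}).
Hypothesis cyc : cyclic_braid n s y.
Hypothesis n7 : 6 < n.
Hypothesis irr : irreducible n s.
Hypothesis noncyc : s 0 <> s 1%N.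
Hypothesis T2n : #|T| <= 2 * n.
Hypothesis inv : forall i p, s i (s i p) = p.
Hypothesis fpf : forall i p, s i p != p.

(** Equivalently, the support of s i * s i.+1, which has order 3 when the s i
    are involutions. *)
Definition moved i := [set p | s i p != s i.+1 p].
Notation U := moved.

Lemma moved_rot i p : (y p \in U i.+1) = (p \in U i).
Proof. by rewrite !inE !(rotate_s cyc) (inj_eq perm_inj). Qed.

Lemma moved_per i : U (i + n)%N = U i.
Proof. by rewrite /moved -addSn !(period_s cyc). Qed.

Lemma moved_com i (g : {perm T}) p : commute g (s i) -> commute g (s i.+1) ->
  (g p \in U i) = (p \in U i).
Proof. by move=> gi gi1; rewrite !inE -!permM gi gi1 !permM (inj_eq perm_inj). Qed.

Lemma permsq i : s i * s i = 1.
Proof. by apply/permP => p; rewrite permM inv perm1. Qed.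

Lemma far_commute i j : far n i j -> commute (s i) (s j).
Proof. by case: cyc => _ _ com _ /andP[ij ji]; apply: com. Qed.

Local Notation u := (s 0 * s 1%N).

Lemma u_cube : u ^+ 3 = 1.
Proof. by apply: braid_involutions_cube; rewrite ?permsq //; case: cyc. Qed.

Lemma moved0E p : (p \in U 0) = (1 < #|porbit u p|).
Proof.
by rewrite ltnNge porbit_le1 inE permM -[X in _ = ~~ (_ == X)](inv 1%N p) (inj_eq perm_inj).
Qed.

(** An orbit of the group generated by s 0 and s 1, as the union of two cycles
    of u that s 0 exchanges. *)
Definition hexagon p := porbit u p :|: porbit u (s 0 p).

Lemma porbit_flip p : porbit u (s 0 p) = s 0 @: porbit u p.
Proof.
rewrite -porbit_conj -porbitV; congr (porbit _ _).
have V i : (s i)^-1 = s i by apply: mulg1_eq; apply: permsq.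
by rewrite invMg conjgE !V !mulgA permsq mul1g.
Qed.

Lemma hexagonE p q : q \in hexagon p -> hexagon q = hexagon p.
Proof.
rewrite /hexagon in_setU -!eq_porbit_mem !porbit_flip => /orP[] /eqP -> //.
rewrite -imset_comp setUC; congr (_ :|: _).
by rewrite (eq_imset _ (g := id)) ?imset_id // => z /=; rewrite inv.
Qed.

(** The group generated by s 0 and s 1 is a copy of S_3, which acts freely on the
    points that u moves: its involutions and u have no fixed point there. *)
Lemma hexagon_moved p : p \in U 0 -> [/\ p \in hexagon p, hexagon p \subset U 0 & 6 <= #|hexagon p|].
Proof.
move=> pU; rewrite in_setU porbit_id; split=> //.
  apply/subsetP => q; rewrite !moved0E in_setU -!eq_porbit_mem porbit_flip.
  move: pU; rewrite moved0E => pU /orP[] /eqP -> //.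
  by rewrite card_imset //; apply: perm_inj.
have dis : [disjoint porbit u p & porbit u (s 0 p)].
  apply/pred0P => z /=; apply/negP; rewrite -!eq_porbit_mem => /andP[/eqP -> ].
  rewrite eq_sym eq_porbit_mem => /porbitP[k].
  rewrite -(expg_mod _ u_cube); have : k %% 3 < 3 by rewrite ltn_mod.
  case: (k %% 3) => [|[|[|//]]] _; rewrite ?expg0 ?expg1 ?perm1.
  - by move/eqP; rewrite (negbTE (fpf _ _)).
  - by rewrite permM => /esym/eqP; rewrite (negbTE (fpf _ _)).
  - move=> e; have : u (s 0 p) = p by rewrite e -permM -expgSr u_cube perm1.
    by rewrite permM inv => /eqP; rewrite (negbTE (fpf _ _)).
have c3 : 3 <= #|porbit u p|.
  move: pU; rewrite moved0E; have := iter_porbit u p.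
  case: #|_| (card_porbit_neq0 u p) (porbit_le1 u p) => [|[|[|//]]] //= _ up2 u2 _.
  have : u (u (u p)) = p by rewrite -perm_cube u_cube perm1.
  by rewrite u2 => e; move: up2; rewrite e eqxx.
rewrite /hexagon cardsU disjoint_setI0 // cards0 subn0 porbit_flip card_imset; last exact: perm_inj.
by rewrite (leq_add c3 c3).
Qed.

Lemma hexagon_conj (g : {perm T}) p : commute g (s 0) -> commute g (s 1%N) ->
  hexagon (g p) = g @: hexagon p.
Proof.
move=> g0 g1; have gu : u ^ g = u.
  by apply/conjg_fixP/commgP/commute_sym/commuteM.
rewrite /hexagon imsetU -!porbit_conj gu; congr (_ :|: porbit _ _).
by rewrite -!permM g0.
Qed.

Lemma card_hexagons : 6 * #|hexagon @: U 0| <= #|U 0|.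
Proof.
apply: card_classes => [p|p q _]; [exact: hexagon_moved|exact: hexagonE].
Qed.

Section CubeInCycle.
Variable a : {perm T}.
Hypotheses (a0 : commute a (s 0)) (a1 : commute a (s 1%N)) (a3 : a ^+ 3 = 1).

Lemma cube_porbit p : porbit u (a p) = a @: porbit u p.
Proof.
rewrite -porbit_conj; congr (porbit _ _).
by apply/esym/conjg_fixP/commgP/commute_sym/commuteM.
Qed.

(** Exchanging the two cycles of u that make up a hexagon is an operation of
    order 2, out of reach for an element of order 3. *)
Lemma cube_in_cycle p : a p \in hexagon p -> a p \in porbit u p.
Proof.
rewrite in_setU => /orP[//|]; rewrite -!eq_porbit_mem => /eqP e1.
have e2 : porbit u (a (a p)) = porbit u p.
  rewrite cube_porbit e1 -cube_porbit -permM -a0 permM porbit_flip e1 -porbit_flip inv //.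
have e3 : porbit u (a (a (a p))) = porbit u (a p) by rewrite cube_porbit e2 -cube_porbit.
by rewrite -e3 -perm_cube a3 perm1.
Qed.

(** At most 14 points leave room for at most two hexagons, which an element of
    order 3 cannot exchange. *)
Lemma cube_hexagon p : n = 7 -> p \in U 0 -> hexagon (a p) = hexagon p.
Proof.
move=> n_7 pU.
have hE q : hexagon (a q) = a @: hexagon q by apply: hexagon_conj.
have aU q : q \in U 0 -> a q \in U 0 by rewrite moved_com.
have c2 : #|hexagon @: U 0| <= 2.
  have le : #|U 0| <= 14 by apply: leq_trans (max_card _) _; lia.
  by have := leq_trans card_hexagons le; lia.
have hU q : q \in U 0 -> hexagon q \in hexagon @: U 0 by apply: imset_f.
have [//|ne1] := eqVneq (hexagon (a p)) (hexagon p).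
have [e|ne2] := eqVneq (hexagon (a (a p))) (hexagon (a p)).
  by move: e; rewrite !hE => /imset_inj; apply; apply: perm_inj.
have [e|ne3] := eqVneq (hexagon (a (a p))) (hexagon p).
  by rewrite hE -e -hE -perm_cube a3 perm1.
have : uniq [:: hexagon p; hexagon (a p); hexagon (a (a p))].
  by rewrite /= !inE negb_or eq_sym ne1 eq_sym ne3 eq_sym ne2.
move=> /card_uniqP /= c3; move: c2; rewrite leqNgt -c3; case/negP.
apply/subset_leq_card/subsetP => X; rewrite !inE => /or3P[] /eqP ->; apply: hU; auto.
Qed.

End CubeInCycle.

Lemma stable_moved j : far n 0 j -> far n 1 j -> stable (U 0) (s j).
Proof.
move=> f0 f1 p pU; rewrite moved_com //; apply: commute_sym; exact: far_commute.
Qed.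

(** There are at most n / 3 hexagons of moved points, fewer than n - 3, and the
    generators far from s 0 and s 1 form a copy of B_(n-3). *)
Lemma hexagon_far p i j : p \in U 0 -> 2 < i -> i.+1 < n -> 2 < j -> j.+1 < n ->
  7 < n -> hexagon (s i p) = hexagon (s j p).
Proof.
move=> pU i3 i_n j3 jn n8.
have TA : constant_below (n - 3) by apply: artin_constant_below; lia.
have e : (n - 3 + 3)%N = n by lia.
have art : artin (n - 3) (fun i => s (i + 3)%N).
  apply: (@artin_shift _ (n - 3) s 3); rewrite e.
  by apply: (cyclic_artin cyc); lia.
have fa k : k.+1 < n - 3 -> far n 0 (k + 3) /\ far n 1 (k + 3).
  by move=> km; split; unfold far; lia.
have st k : k.+1 < n - 3 -> stable (U 0) (s (k + 3)%N).
  by move=> /fa[f0 f1]; apply: stable_moved.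
have kE k q : k.+1 < n - 3 -> q \in U 0 -> hexagon (s (k + 3)%N q) = s (k + 3)%N @: hexagon q.
  move=> /fa[f0 f1] _; apply: hexagon_conj; apply: commute_sym; exact: far_commute.
have lt : #|hexagon @: U 0| < n - 3.
  have le : #|U 0| <= 2 * n by apply: leq_trans (max_card _) _; lia.
  by have := leq_trans card_hexagons le; lia.
have H := artin_agree_blocks TA art st kE lt.
have -> : i = (i - 3 + 3)%N by lia.
have -> : j = (j - 3 + 3)%N by lia.
by rewrite H 1?[RHS]H //; lia.
Qed.

Lemma hexagon_step i p : (i == 3) || (i == 5) -> p \in U 0 ->
  s i (s 4 p) \in hexagon p.
Proof.
move=> i35 pU.
have f04 : far n 0 4 by unfold far; lia.
have f14 : far n 1 4 by unfold far; lia.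
have f0i : far n 0 i by unfold far; lia.
have f1i : far n 1 i by unfold far; lia.
have c4 : s 4 p \in U 0 by apply: stable_moved.
have ci : s i (s 4 p) \in U 0 by apply: stable_moved.
suff <- : hexagon (s i (s 4 p)) = hexagon p by case: (hexagon_moved ci).
have [n_7|n8] := eqVneq n 7; last first.
  by rewrite (@hexagon_far _ i 4) ?inv //; lia.
rewrite -permM; apply: cube_hexagon => //.
- by apply/commute_sym/commuteM; exact: far_commute.
- by apply/commute_sym/commuteM; exact: far_commute.
- apply: braid_involutions_cube; rewrite ?permsq //.
  by case: cyc => _ _ _ brd; case/orP: i35 => /eqP ->; rewrite brd.
Qed.

(** The elements s 3 s 4 and s 5 s 4 of order 3 preserve the cycles of u by the
    preceding lemmas, so they commute on the points moved by u. *)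
Lemma moved_agree35 p : p \in U 0 -> s 3 p = s 5 p.
Proof.
have cub i : (i == 3) || (i == 5) -> (s 4 * s i) ^+ 3 = 1.
  move=> i35; apply: braid_involutions_cube; rewrite ?permsq //.
  by case: cyc => _ _ _ brd; case/orP: i35 => /eqP ->; rewrite brd.
have st i : (i == 3) || (i == 4) || (i == 5) -> stable (U 0) (s i).
  by move=> i35; apply: stable_moved; unfold far; lia.
have cm i j : (i == 3) || (i == 4) || (i == 5) -> (j == 0) || (j == 1%N) -> commute (s i) (s j).
  by move=> i35 j01; apply/commute_sym/far_commute; unfold far; lia.
have near i q : (i == 3) || (i == 5) -> q \in U 0 -> (s 4 * s i) q \in porbit u q.
  move=> i35 qU; apply: cube_in_cycle; try exact: cub; last first.
  - by rewrite permM hexagon_step.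
  - by apply/commute_sym/commuteM; apply/commute_sym/cm => //; lia.
  - by apply/commute_sym/commuteM; apply/commute_sym/cm => //; lia.
have uc i : (i == 3) || (i == 5) -> commute u (s 4 * s i).
  move=> i35; apply/commute_sym/commuteM; apply/commute_sym/commuteM; apply/commute_sym/cm; lia.
pose S i := sub_perm (U 0) (s i).
have S2 i : (i == 3) || (i == 4) || (i == 5) -> S i * S i = 1.
  move=> i35; apply/permP => v; apply: val_inj.
  by rewrite permM !sub_permE ?inv ?perm1 //; apply: st.
have Sbrd i : (i == 3) || (i == 5) -> S 4 * S i * S 4 = S i * S 4 * S i.
  move=> i35; apply/permP => v; apply: val_inj.
  rewrite !permM !sub_permE; try (by apply: st; lia).
  by case/orP: i35 => /eqP ->; rewrite (braidE cyc).
move=> pU; suff e : S 3 = S 5.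
  have := congr1 (fun g : {perm _} => val (g (Sub p pU))) e.
  by rewrite /= !sub_permE //; apply: st.
apply: (@braid_involutions_eq _ _ _ (S 4)); rewrite ?S2 ?Sbrd //.
  apply/permP => v; apply: val_inj; rewrite !permM !sub_permE; try (by apply: st).
  by rewrite -(far_com (i := 3) (j := 5) cyc) //; unfold far; lia.
apply/permP => v; apply: val_inj; rewrite !permM !sub_permE; try (by apply: st).
have := @orbit_commute _ (s 4 * s 3) (s 4 * s 5) u (val v).
rewrite !permM => -> //; [exact: uc|exact: uc| |].
  by rewrite -permM near //; exact: valP.
by rewrite -permM near //; exact: valP.
Qed.

Lemma moved_agree_rot i p : p \in U i -> s (i + 3)%N p = s (i + 5)%N p.
Proof.
elim: i p => [|i IH] p; first exact: moved_agree35.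
by rewrite -(permKV y p) moved_rot !addSn !(rotate_s cyc) => /IH ->.
Qed.

(** The equality of s 3 and s 5 makes s 5 commute with s 6, hence equal to it;
    then s 5 = s 6 commutes with s 4, and equals it too. *)
Lemma moved_agree_large : 7 < n -> forall j p, p \in U 0 -> 2 < j -> j.+1 < n -> s j p = s 3 p.
Proof.
move=> n8 j p pU j3 jn.
have fa k : k.+1 < n - 3 -> far n 0 (k + 3) /\ far n 1 (k + 3).
  by move=> km; split; unfold far; lia.
have st k : k.+1 < n - 3 -> stable (U 0) (s (k + 3)%N).
  by move=> /fa[f0 f1]; apply: stable_moved.
have e : (n - 3 + 3)%N = n by lia.
have art : artin (n - 3) (fun i => s (i + 3)%N).
  apply: (@artin_shift _ (n - 3) s 3); rewrite e.
  by apply: (cyclic_artin cyc); lia.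
have [com brd] := artin_sub_perm art st.
have e35 : sub_perm (U 0) (s 3) = sub_perm (U 0) (s 5).
  apply/permP => v; apply: val_inj; rewrite !sub_permE; first exact/moved_agree35/valP.
    by apply: (st 2); lia.
  by apply: (st 0); lia.
have e56 : sub_perm (U 0) (s 5) = sub_perm (U 0) (s 6).
  apply: braid_commute_eq; first by apply: (brd 2); lia.
  by rewrite -e35; apply: (com 0 3); lia.
have e45 : sub_perm (U 0) (s 4) = sub_perm (U 0) (s 5).
  apply: braid_commute_eq; first by apply: (brd 1%N); lia.
  by rewrite e56; apply: (com 1%N 3); lia.
have := agree_of_sub_perm art st; rewrite !add0n !add1n e35 e45 => /(_ erefl (j - 3) p).
by rewrite subnK //; apply => //; lia.
Qed.

End Hexagons.

Section MovedPoints.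
Variables (T : finType) (n : nat) (s : nat -> {perm T}) (y : {perm T}).
Hypothesis cyc : cyclic_braid n s y.
Hypothesis n7 : 6 < n.
Hypothesis irr : irreducible n s.
Hypothesis noncyc : s 0 <> s 1%N.
Hypothesis T2n : #|T| <= 2 * n.
Hypothesis inv : forall i p, s i (s i p) = p.
Hypothesis fpf : forall i p, s i p != p.

Notation U := (moved s).

Lemma in_moved i p : (p \in U i) = (s i p != s i.+1 p). Proof. by rewrite inE. Qed.

Lemma moved_agree p j : p \in U 0 -> 2 < j -> j.+1 < n -> s j p = s 3 p.
Proof.
move=> pU j3 jn.
have [n_7|n8] := eqVneq n 7; last first.
  by apply: (moved_agree_large cyc n7 T2n inv fpf) => //; lia.
(* For n = 7, each place where consecutive generators differ at p forces an
   equality further on; two places at distance 3 force too many of them. *)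
have R i : s i p != s i.+1 p -> s (i + 3)%N p = s (i + 5)%N p.
  by rewrite -in_moved; apply: (moved_agree_rot cyc).
have per i : s (i + 7)%N p = s i p by rewrite -n_7 (period_s cyc).
have n01 : s 0 p != s 1%N p by rewrite -in_moved.
have e35 := R 0 n01; rewrite !add0n in e35.
suff e34 : s 3 p = s 4 p by move: j3 jn; rewrite n_7; case: j => [|[|[|[|[|[|]]]]]].
apply/eqP; apply: contraT => n34.
have e61 := R 3 n34; rewrite (per 1%N) in e61.
have e02 : s 0 p = s 2 p.
  by have := R 4; rewrite (per 0) (per 2); apply; rewrite -e35 eq_sym.
have e46 : s 4 p = s 6 p by apply: (R 1%N); rewrite -e02 eq_sym.
have e24 : s 2 p = s 4 p.
  have := R 6; rewrite (per 2) (per 4); apply.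
  by rewrite -[7]/(0 + 7)%N per e61 eq_sym.
by move: n01; rewrite e02 e24 e46 e61 eqxx.
Qed.

Lemma moved_far i j p : i + 3 <= j -> j + 3 <= i + n -> p \in U i -> p \notin U j.
Proof.
elim: i j p => [|i IH] [|j] p ij ji //; try lia; last first.
  by rewrite -(permKV y p) !(moved_rot cyc); apply: IH; lia.
move=> pU; rewrite in_moved negbK; apply/eqP.
by rewrite (@moved_agree p j.+1) ?(@moved_agree p j.+2) //; lia.
Qed.

(** Three consecutive moved sets meet over one strand. *)
Definition block l := U (l + n.-2)%N :&: U (l + n.-1)%N :&: U l.
Notation B := block.

Lemma block_rot l p : (y p \in B l.+1) = (p \in B l).
Proof. by rewrite !in_setI !(moved_rot cyc). Qed.

Lemma block_per l : B (l + n)%N = B l.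
Proof.
rewrite /block !(moved_per cyc).
have -> : (l + n + n.-2 = l + n.-2 + n)%N by lia.
have -> : (l + n + n.-1 = l + n.-1 + n)%N by lia.
by rewrite !(moved_per cyc).
Qed.

Lemma block_notin l j p : p \in B l -> l < j -> j + 3 <= l + n -> p \notin U j.
Proof.
rewrite !in_setI => /andP[/andP[p2 p1] p0] lj jl.
have [j1|j1] := eqVneq j l.+1.
  rewrite j1 -(moved_per cyc); apply: moved_far p2; lia.
have [j2|j2] := eqVneq j l.+2.
  rewrite j2 -(moved_per cyc); apply: moved_far p2; lia.
apply: moved_far p0; lia.
Qed.

(** The indices l, l - 1 and l - 2 modulo n, for l and j below n. *)
Definition in_window l j :=
  [|| j == l, j.+1 == l, j.+2 == l, j.+1 == (l + n)%N | j.+2 == (l + n)%N].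

Lemma block_window l j p : l < n -> j < n -> p \in B l -> (p \in U j) = in_window l j.
Proof.
move=> ln jn pB; have := pB; rewrite !in_setI => /andP[/andP[p2 p1] p0].
apply/idP/idP => [pU|].
  apply: contraLR pU => nw; have [lj|jl] := ltnP l j.
    by apply: (block_notin pB); move: nw; rewrite /in_window; lia.
  rewrite -(moved_per cyc); apply: (block_notin pB); move: nw; rewrite /in_window; lia.
case/or4P => [/eqP-> //|/eqP e|/eqP e|/orP[]/eqP e].
- by have e' : (l + n.-1 = j + n)%N; [lia|rewrite e' (moved_per cyc) in p1].
- by have e' : (l + n.-2 = j + n)%N; [lia|rewrite e' (moved_per cyc) in p2].
- by have e' : (l + n.-1 = j)%N; [lia|rewrite e' in p1].
- by have e' : (l + n.-2 = j)%N; [lia|rewrite e' in p2].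
Qed.

Lemma block_disjoint j p : 0 < j -> j < n -> p \in B 0 -> p \notin B j.
Proof.
move=> j0 jn pB; apply/negP => pj.
have n0 : 0 < n by lia.
have := block_window n0 jn pB; have := block_window jn n0 pj.
have := block_window n0 n0 pB; have := block_window jn jn pj.
have n1 : n.-1 < n by lia.
have := block_window n0 n1 pB; have := block_window jn n1 pj.
by rewrite /in_window; case: (_ \in _); case: (_ \in _); case: (_ \in _); lia.
Qed.

Definition moved_count p := #|[set i : 'I_n | p \in U i]|.

Lemma last_moved p : (exists i : 'I_n, p \in U i) ->
  exists l, [/\ p \in U l, p \notin U l.+1 & p \notin U l.+2].
Proof.
case=> i pi.
have no3 : p \notin U i.+3 by apply: moved_far pi; lia.
have no4 : p \notin U i.+4 by apply: moved_far pi; lia.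
have [p2|n2] := boolP (p \in U i.+2); first by exists i.+2.
have [p1|n1] := boolP (p \in U i.+1); first by exists i.+1.
by exists i.
Qed.

(** Moved sets at circular distance at least 3 are disjoint, so the indices of
    those that contain p lie in a window of three; l is the last of them. *)
Lemma moved_count_le3 p : moved_count p <= 3 /\ (moved_count p = 3 -> exists l : 'I_n, p \in B l).
Proof.
have n0 : 0 < n by lia.
have [ex|nex] := boolP [exists i : 'I_n, p \in U i]; last first.
  have -> : moved_count p = 0.
    by apply: eq_card0 => i; rewrite inE; apply: negbTE; move/existsPn: nex; apply.
  by [].
have [l0 []] := last_moved (existsP ex).
rewrite -(periodic_mod (moved_per cyc)) -(periodic_mod (moved_per cyc) l0.+1) -(periodic_mod (moved_per cyc) l0.+2) => pl pl1 pl2.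
pose l := l0 %% n.
have ln : l < n by rewrite ltn_mod.
have {}pl1 : p \notin U l.+1 by rewrite -(periodic_mod (moved_per cyc)) -addn1 modnDml addn1.
have {}pl2 : p \notin U l.+2 by rewrite -(periodic_mod (moved_per cyc)) -addn2 modnDml addn2.
rewrite -/l in pl; clearbody l; clear l0.
pose o j := Ordinal (ltn_pmod j n0).
have sub : [set i : 'I_n | p \in U i] \subset [set o (l + n.-2)%N; o (l + n.-1)%N; o l].
  apply/subsetP => i; rewrite inE => pU; rewrite !inE -!val_eqE /=.
  have far3 j : l + 3 <= j -> j + 3 <= l + n -> p \notin U j.
    by move=> *; apply: moved_far pl.
  have ni j : U j = U i -> ~ (l < j /\ j + 3 <= l + n).
    move=> e [lj jl]; move: pU; rewrite -e; apply/negP.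
    have [->//|j1] := eqVneq j l.+1; have [->//|j2] := eqVneq j l.+2.
    by apply: far3; lia.
  have h1 := ni i erefl; have h2 := ni _ (moved_per cyc i).
  have i_n := ltn_ord i.
  rewrite (modn_small ln).
  have [e|ne] := eqVneq (i : nat) l; first by rewrite orbT.
  have [e|e] : i = (l + n.-1)%N :> nat \/ i = (l + n.-2)%N :> nat \/
     (i + n)%N = (l + n.-1)%N \/ (i + n)%N = (l + n.-2)%N by move: ne => /eqP; lia.
  - by rewrite -e (modn_small i_n) eqxx orbT.
  - case: e => [e|[e|e]]; first by rewrite -e (modn_small i_n) eqxx.
      by rewrite -e modnDr (modn_small i_n) eqxx orbT.
    by rewrite -e modnDr (modn_small i_n) eqxx.
have le3 : #|[set o (l + n.-2)%N; o (l + n.-1)%N; o l]| <= 3.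
  rewrite -!setUA -/(o _) cardsU1 cards2; do !case: (_ \in _) => //; by case: (_ != _).
split; first exact: leq_trans (subset_leq_card sub) le3.
move=> c3; have eS : [set i : 'I_n | p \in U i] = [set o (l + n.-2)%N; o (l + n.-1)%N; o l].
  by apply/eqP; rewrite eqEcard sub -/(moved_count p) c3.
exists (Ordinal ln); rewrite /= !in_setI -(periodic_mod (moved_per cyc) (l + n.-2)) -(periodic_mod (moved_per cyc) (l + n.-1)).
have inS i : i \in [set o (l + n.-2)%N; o (l + n.-1)%N; o l] -> p \in U i.
  by rewrite -eS inE.
have -> : p \in U ((l + n.-2) %% n) by apply: (inS (o _)); rewrite !inE eqxx.
have -> : p \in U ((l + n.-1) %% n) by apply: (inS (o _)); rewrite !inE eqxx orbT.
by rewrite -(periodic_mod (moved_per cyc) l); apply: (inS (o _)); rewrite !inE eqxx !orbT.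
Qed.

Lemma card_moved i : #|U i| = #|U 0|.
Proof. exact: (card_rotating (moved_rot cyc)). Qed.

Lemma card_moved_ge6 : 6 <= #|U 0|.
Proof.
have [p pU] : exists p, p \in U 0.
  apply/existsP; apply: contra_notT noncyc => /existsPn no.
  by apply/permP => p; apply/eqP; have := no p; rewrite in_moved negbK.
have [_ /subset_leq_card sub] := hexagon_moved cyc inv fpf pU.
by move=> /leq_trans; apply.
Qed.

Lemma sum_moved_count : (\sum_(p : T) moved_count p = n * #|U 0|)%N.
Proof.
transitivity (\sum_(p : T) \sum_(i < n) (p \in U i))%N.
  apply: eq_bigr => p _; rewrite /moved_count -sum1_card big_mkcond /=.
  by apply: eq_bigr => i _; rewrite inE; case: (p \in _).
rewrite exchange_big /= -[in RHS](card_ord n) -sum_nat_const.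
apply: eq_bigr => i _; rewrite -(card_moved i) -sum1_card [RHS]big_mkcond /=.
by apply: eq_bigr => p _; case: (p \in _).
Qed.

(** Double counting: n moved sets of at least 6 points each, and every point in
    at most 3 of them, while there are at most 2 n points. Equality must hold
    throughout. *)
Lemma block_cover p : exists l : 'I_n, p \in B l.
Proof.
have [le3 +] := moved_count_le3 p; apply; apply/eqP; rewrite eqn_leq le3 ltnNge.
apply/negP => le2.
have : \sum_(q : T) moved_count q <= \sum_(q : T) 3 - 1.
  rewrite (bigD1 p) //= [X in _ <= X - _](bigD1 p) //=.
  have : \sum_(q | q != p) moved_count q <= \sum_(q | q != p) 3.
    by apply: leq_sum => q _; case: (moved_count_le3 q).
  by lia.
rewrite sum_moved_count sum_nat_const; have := card_moved_ge6.
have := T2n; rewrite cardT; nia.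
Qed.

Lemma card_block0 : #|B 0| <= 2.
Proof.
have cB := card_rotating block_rot.
have n4 : 4 < n by lia.
have cov : #|\bigcup_(i < n) B i| = (n * #|B 0|)%N.
  apply: card_disjoint_family => // i j q ij jn.
  by apply: (blocks_disjoint n4 block_rot block_disjoint) => //; lia.
have := max_card (mem (\bigcup_(i < n) B i)); rewrite cov.
have := T2n; nia.
Qed.

(** Only moved 1 and moved n.-2 involve a generator that is adjacent to s 0
    without s 0 itself. *)
Lemma moved_flip p i : i < n -> i != 1%N -> i != n.-2 -> (s 0 p \in U i) = (p \in U i).
Proof.
move=> i_n i1 in2; have [->|i0] := eqVneq i 0.
  by rewrite !in_moved inv -[in LHS](inj_eq (@perm_inj _ (s 1%N))) inv eq_sym.
have [e|in1] := eqVneq i n.-1.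
  have sn : s i.+1 = s 0 by rewrite -(period_s cyc 0); congr s; lia.
  by rewrite !in_moved sn inv -[in LHS](inj_eq (@perm_inj _ (s i))) inv eq_sym.
by rewrite moved_com //; apply: (far_commute cyc); unfold far; lia.
Qed.

(** The window of l can be read off the indices other than 1 and n.-2, up to
    the confusion of 0 with 1; in each case a single index separates. *)
Lemma window_inj l l' : l < n -> l' < n ->
  (forall j, j < n -> j != 1%N -> j != n.-2 -> in_window l j = in_window l' j) ->
  if 1 < l then l' = l else l' <= 1.
Proof.
move=> ln ln' H.
have sep j : j < n -> j != 1%N -> j != n.-2 ->
    in_window l j != in_window l' j -> False.
  by move=> jn j1 j2; rewrite H ?eqxx.
unfold in_window in sep; case: ltnP => [l1|l1]; last first.
  rewrite leqNgt; apply/negP => l'1.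
  have [l'2|l'2] := eqVneq l' 2; first by apply: (sep 2); lia.
  by apply: (sep 0); lia.
apply/eqP; apply: contraT => ne; exfalso; case: (ltngtP l' l) => [lt|lt|e].
- have [e1|ne1] := eqVneq l n.-1; first by apply: (sep (if l' <= 1 then n - 3 else l)); case: ifP; lia.
  have [e2|ne2] := eqVneq l n.-2; last by apply: (sep l); lia.
  by apply: (sep (if l' == n - 3 then n - 5 else n - 3)); case: ifP; lia.
- have [e2|ne2] := eqVneq l' n.-2; last by apply: (sep l'); lia.
  by apply: (sep (if l == n - 3 then n - 5 else n - 3)); case: ifP; lia.
- by rewrite e eqxx in ne.
Qed.

Lemma flip_block l p : l < n -> p \in B l ->
  exists l', s 0 p \in B l' /\ if 1 < l then l' = l else l' <= 1.
Proof.
move=> ln pB; have [[l' ln'] pB'] := block_cover (s 0 p).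
exists l'; split=> //; apply: window_inj => // j jn j1 jn2.
by rewrite -(block_window ln jn pB) -(block_window ln' jn pB') moved_flip.
Qed.

Lemma fpf_labelling : exists lam, labelling n s lam.
Proof.
have n4 : 4 < n by lia.
have stepBn l p : 1 < l -> l < n -> p \in B l -> s 0 p \in B l.
  by move=> l1 ln pB; have [l' [pB' ]] := flip_block ln pB; rewrite l1 => <-.
have step01 l p : l <= 1 -> p \in B l -> s 0 p \in B 0 \/ s 0 p \in B 1%N.
  move=> l1 pB; have ln : l < n by lia.
  have [l' [pB' ]] := flip_block ln pB; rewrite ltnNge l1 /=.
  by case: l' pB' => [|[|//]]; [left|right].
have st1 p : p \in B 0 -> s 1%N p \in B 0.
  rewrite -(block_per 0) -(permKV y p) add0n -[n]prednK ?block_rot; last by lia.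
  by rewrite (rotate_s cyc) !block_rot; apply: stepBn; lia.
have stepB0 p : p \in B 0 -> s 0 p \in B 1%N.
  move=> pB; have [p0|//] := step01 0 p isT pB.
  have pU : p \in U 0 by move: pB; rewrite in_setI => /andP[].
  (* Otherwise s 0 p and s 1 p would both lie, with p, in the block of p. *)
have := card_block0; rewrite leqNgt => /negP; case.
  have : uniq [:: p; s 0 p; s 1%N p].
    by rewrite /= !inE negb_or !(eq_sym p) !fpf -in_moved pU.
  move=> /card_uniqP /= <-; apply/subset_leq_card/subsetP => q.
  by rewrite !in_cons in_nil orbF => /or3P[] /eqP ->; rewrite ?pB ?p0 ?st1.
apply: (labelling_of_blocks cyc n4 irr (B := B)) => //.
- exact: block_rot.
- exact: block_per.
- exact: block_disjoint.
- by move=> p; apply: step01.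
have [p _] : exists p : T, true by have /card_gt0P[p _] := noncyclic_card_gt0 noncyc; exists p.
have [l pB] := block_cover p.
have : forall k q, q \in B k -> B 0 != set0.
  elim=> [|k IH] q qB; first by apply/set0Pn; exists q.
  by move: qB; rewrite -(permKV y q) block_rot; apply: IH.
by apply; exact: pB.
Qed.

End MovedPoints.

(** On at most 2 n points, a transitive non-cyclic action of B_n maps to the
    action on strands. *)
Theorem labelling_upto_2n (T : finType) n (s : nat -> {perm T}) (y : {perm T}) :
  cyclic_braid n s y -> 6 < n -> irreducible n s -> s 0 <> s 1%N ->
  #|T| <= 2 * n -> exists lam, labelling n s lam.
Proof.
move=> cyc n7 irr noncyc T2n.
have [//|[inv fpf]] := labelling_or_fpf cyc n7 irr noncyc T2n.
exact: (fpf_labelling cyc).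
Qed.

(** * Models of the labelled actions *)

(** Induction on words in the b i and their inverses; G may be infinite. *)
Definition generated_by (G : groupType) n (b : nat -> G) : Prop :=
  forall P : G -> Prop, P 1 ->
    (forall i g, i.+1 < n -> P g -> P (b i * g)) ->
    (forall i g, i.+1 < n -> P g -> P ((b i)^-1 * g)) -> forall g, P g.

Definition group_hom (G K : groupType) (f : G -> K) : Prop := {morph f : g h / g * h}.

Section Actions.
Variables (G : groupType) (n : nat) (b : nat -> G).
Hypothesis gen : generated_by n b.

Lemma group_hom1 (K : groupType) (f : G -> K) : group_hom f -> f 1 = 1.
Proof. by move=> fM; apply: (mulgI (f 1)); rewrite -fM !mulg1. Qed.

Lemma group_homV (K : groupType) (f : G -> K) g : group_hom f -> f g^-1 = (f g)^-1.
Proof. by move=> fM; apply: (mulgI (f g)); rewrite -fM !mulgV group_hom1. Qed.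

(** Equivariance need only be checked on the generators. *)
Lemma equivariant (M T : finType) (psi : G -> {perm M}) (phi : G -> {perm T})
    (mu : M -> T) : group_hom psi -> group_hom phi ->
  (forall i m, i.+1 < n -> mu (psi (b i) m) = phi (b i) (mu m)) ->
  forall g m, mu (psi g m) = phi g (mu m).
Proof.
move=> psiM phiM eqv; elim/gen => [m|i g i_n IH m|i g i_n IH m].
- by rewrite !group_hom1 // !perm1.
- by rewrite psiM phiM !permM IH eqv.
rewrite psiM phiM !permM IH !group_homV //; congr (phi g _).
by apply: (@perm_inj _ (phi (b i))); rewrite -eqv // !permKV.
Qed.

Lemma stable_hom (T : finType) (phi : G -> {perm T}) (Z : {set T}) : group_hom phi ->
  (forall i p, i.+1 < n -> p \in Z -> phi (b i) p \in Z) ->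
  forall g p, p \in Z -> phi g p \in Z.
Proof.
move=> phiM st; elim/gen => [p|i g i_n IH p pZ|i g i_n IH p pZ].
- by rewrite group_hom1 // perm1.
- by rewrite phiM permM; apply/IH/st.
rewrite phiM permM; apply: IH; rewrite group_homV //.
by rewrite -(stable_perm (fun p => @st i p i_n)) permKV.
Qed.

Definition transitive (T : finType) (phi : G -> {perm T}) (p : T) :=
  forall q, exists g, phi g p = q.

Lemma transitive_irreducible (T : finType) (phi : G -> {perm T}) p : group_hom phi ->
  transitive phi p -> irreducible n (fun i => phi (b i)).
Proof.
move=> phiM tr Z /set0Pn[q qZ] st; apply/setP => r; rewrite inE.
have [g gq] := tr q; have [h hr] := tr r.
have -> : r = phi (g^-1 * h) q by rewrite phiM permM group_homV // -gq permK hr.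
exact: stable_hom.
Qed.

End Actions.

Section Model.
Variables (n : nat) (al be : bool).

Definition shift i l := if l == i then false else if l == i.+1 then be else al.
Definition unshift i l := if l == i then be else if l == i.+1 then false else al.

(** Strands that carry a bit: a generator adds al to the bit of the strands that
    it leaves in place, and its square adds be to those that it exchanges. *)
Definition model_fun i (m : 'I_n * bool) : 'I_n * bool :=
  if i.+1 < n then (insubd m.1 (adj_swap i m.1), m.2 (+) shift i m.1) else m.
Definition model_inv i (m : 'I_n * bool) : 'I_n * bool :=
  if i.+1 < n then (insubd m.1 (adj_swap i m.1), m.2 (+) unshift i m.1) else m.

Lemma adj_swap_lt i l : i.+1 < n -> l < n -> adj_swap i l < n.
Proof. by rewrite /adj_swap; do 2?case: eqP; lia. Qed.

Lemma adj_swapK i : involutive (adj_swap i).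
Proof.
move=> l; rewrite /adj_swap; case: (l =P i) => [->|e1]; first by rewrite eqxx; case: eqP => //; lia.
case: (l =P i.+1) => [->|e2]; first by rewrite eqxx.
by do 2?case: eqP.
Qed.

Lemma model_eq (m m' : 'I_n * bool) : m.1 = m'.1 :> nat -> m.2 = m'.2 -> m = m'.
Proof. by case: m m' => [l e] [l' e'] /= /val_inj -> ->. Qed.

Lemma model_funK i : cancel (model_fun i) (model_inv i).
Proof.
case=> l e; have [i_n|ni] := boolP (i.+1 < n); last first.
  by rewrite /model_fun /model_inv !(negbTE ni).
have lE : insubd l (adj_swap i l) = adj_swap i l :> nat by rewrite val_insubd adj_swap_lt.
have -> : model_fun i (l, e) = (insubd l (adj_swap i l), e (+) shift i l).
  by rewrite /model_fun i_n.
rewrite /model_inv i_n; move: (insubd l (adj_swap i l)) lE => l' lE.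
apply: model_eq => /=; first by rewrite val_insubd lE adj_swapK ltn_ord.
rewrite lE -addbA -[RHS]addbF; congr (_ (+) _).
rewrite /unshift /shift /adj_swap; move: (nat_of_ord l) => k.
case: (k =P i) => e1; first by rewrite eqxx; case: eqP => //; lia.
case: (k =P i.+1) => e2; first by rewrite eqxx addbb.
by case: eqP => // _; case: eqP => // _; rewrite addbb.
Qed.

Definition model i : {perm 'I_n * bool} := perm (can_inj (model_funK i)).

Lemma model1 i m : i.+1 < n -> (model i m).1 = adj_swap i m.1 :> nat.
Proof. by move=> i_n; rewrite permE /model_fun i_n /= val_insubd adj_swap_lt. Qed.

Lemma model2 i m : i.+1 < n -> (model i m).2 = m.2 (+) shift i m.1.
Proof. by move=> i_n; rewrite permE /model_fun i_n. Qed.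

Lemma artin_model : artin n model.
Proof.
have E i : ((i == i = true) * (i.+1 == i.+1 = true) * (i.+2 == i.+2 = true) *
    (i.+1 == i = false) * (i == i.+1 = false) * (i.+2 == i = false) *
    (i == i.+2 = false) * (i.+1 == i.+2 = false) * (i.+2 == i.+1 = false))%type.
  by do !split; lia.
split=> [i j ij jn|i i_n]; apply/permP => -[l e]; rewrite !permM; apply: model_eq.
- rewrite !model1 /adj_swap /=; try lia; move: (nat_of_ord l) => k.
  case: (k =P i) => ?; case: (k =P i.+1) => ?; case: (k =P j) => ?; case: (k =P j.+1) => ?;
  by repeat (case: eqP => ?); lia.
- rewrite !model2 ?model1 /= /adj_swap /shift; try lia; move: (nat_of_ord l) => k.
  case: (k =P i) => ?; case: (k =P i.+1) => ?; case: (k =P j) => ?; case: (k =P j.+1) => ?;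
  try (exfalso; lia); repeat (case: eqP => ?); try (exfalso; lia); by case: e al be => [] [] [].
- rewrite !model1 /adj_swap /=; try lia; move: (nat_of_ord l) => k.
  case: (k =P i) => [->|/eqP/negbTE h0]; first by rewrite !E.
  case: (k =P i.+1) => [e1|/eqP/negbTE h1]; first by rewrite ?e1 !E.
  case: (k =P i.+2) => [e2|/eqP/negbTE h2]; first by rewrite ?e2 !E.
  by rewrite ?(h0, h1, h2).
- rewrite !model2 ?model1 /= /adj_swap /shift; try lia; move: (nat_of_ord l) => k.
  case: (k =P i) => [->|/eqP/negbTE h0]; first by rewrite !E; case: e al be => [] [] [].
  case: (k =P i.+1) => [e1|/eqP/negbTE h1]; first by rewrite ?e1 !E; case: e al be => [] [] [].
  case: (k =P i.+2) => [e2|/eqP/negbTE h2].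
    by rewrite ?e2 !E; case: e al be => [] [] [].
  by rewrite ?(h0, h1, h2).
Qed.

End Model.

Section Labelled.
Variables (T : finType) (n : nat) (s : nat -> {perm T}) (lam : T -> nat).
Hypothesis n3 : 2 < n.
Hypothesis art : artin n s.
Hypothesis lab : labelling n s lam.
Variables (p0 p1 : T).
Hypothesis fib : forall q, (lam q == 0) = (q == p0) || (q == p1).

Definition fiber_pt (e : bool) := if e then p1 else p0.

Lemma lam_fiber_pt e : lam (fiber_pt e) = 0.
Proof. by apply/eqP; rewrite fib /fiber_pt; case: e; rewrite eqxx ?orbT. Qed.

Lemma two_point (g : {perm T}) : (forall e, lam (g (fiber_pt e)) = 0) ->
  forall e, g (fiber_pt e) = fiber_pt (e (+) (g p0 != p0)).
Proof.
move=> st e; have inj := @perm_inj _ g.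
have /orP[/eqP g1|/eqP g1] : (g p1 == p0) || (g p1 == p1).
- by rewrite -fib; apply/eqP/(st true).
- have [g0|ne] := eqVneq (g p0) p0.
    have e10 : p1 = p0 by apply: inj; rewrite g1 g0.
    by rewrite /fiber_pt e10 !if_same.
  have g01 : g p0 = p1.
    by apply/eqP; move/eqP: (st false); rewrite fib (negbTE ne).
  by case: e.
have [g0|ne] := eqVneq (g p0) p0; first by case: e.
have g01 : g p0 = p1.
  by apply/eqP; move/eqP: (st false); rewrite fib (negbTE ne).
have e01 : p0 = p1 by apply: inj; rewrite g01 g1.
by move: ne; rewrite g01 -e01 eqxx.
Qed.

Definition far_twist := s 1%N p0 != p0.
Definition square_twist := (s 0 * s 0) p0 != p0.

(** The fibre over strand 0 transported along s 0, s 1, ...: in these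
    coordinates the generators take the form of the model. *)
Fixpoint strand_pt j e : T := if j is j'.+1 then s j' (strand_pt j' e) else fiber_pt e.

Lemma lam_s i p : i.+1 < n -> lam (s i p) = adj_swap i (lam p).
Proof. by case: lab => _ H; apply: H. Qed.

Lemma lam_strand_pt j e : j < n -> lam (strand_pt j e) = j.
Proof.
elim: j => [|j IH] jn /=; first exact: lam_fiber_pt.
by rewrite lam_s // IH; [rewrite /adj_swap eqxx|lia].
Qed.

(** Two consecutive generators act on the fibre over strand 0, of at most two
    points, as commuting shifts; the braid relation makes these shifts equal. *)
Lemma s_fiber i e : 0 < i -> i.+1 < n -> s i (fiber_pt e) = fiber_pt (e (+) far_twist).
Proof.
have st k : 0 < k -> k.+1 < n -> forall e, lam (s k (fiber_pt e)) = 0.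
  by move=> k0 kn e'; rewrite lam_s // lam_fiber_pt /adj_swap; do 2?case: eqP; lia.
case: i => // i _; elim: i e => [|i IH] e i_n; first by rewrite two_point //; apply: st.
have h1 := IH _ (ltnW i_n); have h2 := two_point (st i.+2 isT i_n).
have [_ brd] := art.
have := congr1 (fun g : {perm T} => g (fiber_pt e)) (brd i.+1 i_n).
rewrite /= !permM h1 !h2 !h1 !h2 => eq.
have xyx (a c d : bool) : a (+) c (+) d (+) c = a (+) d by case: a c d => [] [] [].
by move: eq; rewrite !xyx.
Qed.

Lemma far_s i j p : i.+1 < j -> j.+1 < n -> s j (s i p) = s i (s j p).
Proof. by case: art => com _ ij jn; rewrite -!permM (com i j). Qed.

Lemma braid_s i p : i.+2 < n -> s i (s i.+1 (s i p)) = s i.+1 (s i (s i.+1 p)).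
Proof. by case: art => _ brd i_n; rewrite -!permM !mulgA brd. Qed.

Lemma strand_pt_above i j e : j < i -> i.+1 < n -> s i (strand_pt j e) = strand_pt j (e (+) far_twist).
Proof.
elim: j e => [|j IH] e ji i_n /=; first exact: s_fiber.
by rewrite far_s // IH //; lia.
Qed.

(** The square of s j.+1 is conjugate to that of s j, by s j * s j.+1. *)
Lemma strand_pt_square j e : j.+1 < n -> s j (s j (strand_pt j e)) = strand_pt j (e (+) square_twist).
Proof.
elim: j e => [|j IH] e jn /=.
  rewrite -permM; apply: two_point => e'.
  by rewrite permM !lam_s // lam_fiber_pt.
have {1}-> : strand_pt j e = s j.+1 (strand_pt j (e (+) far_twist)) by rewrite strand_pt_above ?addbK.
rewrite -braid_s // -braid_s // IH; last by lia.
rewrite strand_pt_above //; congr (s j (strand_pt j _)).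
by case: e far_twist square_twist => [] [] [].
Qed.

Lemma strand_pt_below i j e : i.+1 < j -> j < n -> s i (strand_pt j e) = strand_pt j (e (+) far_twist).
Proof.
elim: j e => [//|j IH] e ij jn /=.
have [e1|ne] := eqVneq j i.+1.
  by subst j => /=; rewrite braid_s // strand_pt_above.
by rewrite -far_s ?IH //; lia.
Qed.

Lemma strand_pt_model i (m : 'I_n * bool) : i.+1 < n ->
  strand_pt (model n far_twist square_twist i m).1 (model n far_twist square_twist i m).2 = s i (strand_pt m.1 m.2).
Proof.
move=> i_n; rewrite model1 // model2 //; case: m => -[l ln] e /=.
rewrite /adj_swap /shift; case: (l =P i) => [->|ne]; first by rewrite addbF.
case: (l =P i.+1) => [->|ne1] /=; first by rewrite strand_pt_square.
have [li|il] := ltnP l i; first by rewrite strand_pt_above.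
by rewrite strand_pt_below //; lia.
Qed.

Lemma strand_pt_inj j j' e e' : j < n -> j' < n -> strand_pt j e = strand_pt j' e' -> j = j' /\ fiber_pt e = fiber_pt e'.
Proof.
move=> jn j'n eq; have ej : j = j' by rewrite -(lam_strand_pt e jn) eq lam_strand_pt.
split=> //; subst j'; elim: j jn j'n eq => [//|j IH] jn _ /= /perm_inj.
by apply: IH; lia.
Qed.

Lemma strand_pt_surj p : exists e, p = strand_pt (lam p) e.
Proof.
case: lab => lamn _.
have: forall j q, lam q = j -> exists e, q = strand_pt j e.
  elim=> [|j IH] q lq.
    move/eqP: lq; rewrite fib => /orP[] /eqP ->; [by exists false|by exists true].
  have jn : j.+1 < n by rewrite -lq.
  have [|e qe] := IH ((s j)^-1 q); last by exists e; rewrite /= -qe permKV.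
  have : adj_swap j (lam ((s j)^-1 q)) = j.+1 by rewrite -lam_s // permKV.
  by rewrite /adj_swap; do 2?case: eqP; lia.
by apply.
Qed.

End Labelled.

(** * Classification of the transitive actions *)

(** On strand 0 the bit is toggled by s 1 if al holds, and by the return trip to
    strand 1 if be holds; the bits are invariant otherwise. *)
Lemma model_reach n al be (Z : {set 'I_n * bool}) (m : 'I_n * bool) : 3 < n ->
  (forall i q, i.+1 < n -> q \in Z -> model n al be i q \in Z) -> m \in Z ->
  (forall l, (l, m.2) \in Z) /\ (al || be -> Z = [set: 'I_n * bool])
  \/ (al || be /\ Z = [set: 'I_n * bool]).
Proof.
move=> n3 st mZ.
pose Q l e := exists2 q, q \in Z & q.1 = l :> nat /\ q.2 = e.
have mv i l e : i.+1 < n -> Q l e -> Q (adj_swap i l) (e (+) shift al be i l).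
  move=> i_n [q qZ [q1 q2]]; exists (model n al be i q); first exact: st.
  by rewrite model1 // model2 // q1 q2.
have up l e : l.+1 < n -> Q l e -> Q l.+1 e.
  by move=> ln /(mv l _ _ ln); rewrite /adj_swap /shift eqxx addbF.
have down l e : l.+1 < n -> Q l.+1 e -> Q l (e (+) be).
  move=> ln /(mv l _ _ ln); rewrite /adj_swap /shift eqxx.
  by have -> : (l.+1 == l) = false by lia.
have off i e : 0 < i -> i.+1 < n -> Q 0 e -> Q 0 (e (+) al).
  move=> i0 i_n /(mv i _ _ i_n); rewrite /adj_swap /shift.
  by have -> : (0 == i) = false by lia.
have up0 l e : l < n -> Q 0 e -> Q l e.
  by elim: l => [//|l IH] ln q0; apply: up => //; apply: IH => //; lia.
have QZ (l : 'I_n) e : Q l e -> (l, e) \in Z.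
  by case=> -[l' e'] qZ /= [/val_inj e1 e2]; rewrite -e1 -e2.
have mQ : Q m.1 m.2 by exists m.
have to0 l e : l < n -> Q l e -> exists2 e', Q 0 e' & ~~ be -> e' = e.
  elim: l e => [|l IH] e ln ql; first by exists e.
  have [|e' q0 e'E] := IH (e (+) be) (ltnW ln); first exact: down.
  by exists e' => // nb; rewrite e'E // (negbTE nb) addbF.
have [e' q0 e'E] := to0 _ _ (ltn_ord m.1) mQ.
have [ab|] := boolP (al || be); last first.
  rewrite negb_or => /andP[na nb]; left; split=> // l.
  by apply: QZ; rewrite -e'E //; apply: up0.
right; split=> //.
(* A twist makes both bits of strand 0 accessible. *)
have q0' : Q 0 (~~ e').
  have [a|na] := boolP al.
    by have := off 1%N e' isT _ q0; rewrite a addbT; apply; lia.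
  have b : be by move: ab; rewrite (negbTE na).
  by have := down 0 e' _ (up 0 e' _ q0); rewrite b addbT; apply; lia.
apply/setP => -[l e]; rewrite inE; apply: QZ; apply: up0 => //.
have [->//|ne] := eqVneq e e'.
by have -> : e = ~~ e' by case: e e' ne {q0 q0' e'E} => [] [].
Qed.

Section Classify.
Variables (G : groupType) (n : nat) (b : nat -> G).
Hypothesis n7 : 6 < n.
Hypothesis gen : generated_by n b.
Hypothesis artb : artin n b.

Lemma artin_hom (K : groupType) (f : G -> K) : group_hom f -> artin n (fun i => f (b i)).
Proof.
case: artb => com brd fM; split=> [i j ij jn|i i_n].
  by rewrite -!fM com.
by rewrite -!fM brd.
Qed.

Variable psi : bool -> bool -> G -> {perm 'I_n * bool}.
Hypothesis psiM : forall al be, group_hom (psi al be).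
Hypothesis psiE : forall al be i, i.+1 < n -> psi al be (b i) = model n al be i.

(** Toggling all bits commutes with the model, so the choice of the bit does not
    affect the stabilizers. *)
Lemma psi_flip al be g l e :
  psi al be g (l, ~~ e) = ((psi al be g (l, e)).1, ~~ (psi al be g (l, e)).2).
Proof.
pose fl (m : 'I_n * bool) := (m.1, ~~ m.2).
have := equivariant gen (psiM al be) (psiM al be) (mu := fl).
move=> H; rewrite -[(_, ~~ _)]/(fl (_, _)) -H // => i m i_n.
rewrite psiE //; apply: model_eq => /=; rewrite ?model1 // !model2 //=.
by rewrite addNb.
Qed.

Lemma psi_fix al be g l e :
  psi al be g (l, e) = (l, e) <-> psi al be g (l, false) = (l, false).
Proof.
case: e => //; split=> [e|e].
  have := psi_flip al be g l false; rewrite /= e.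
  by case: (psi _ _ _ _) => l' [] [->].
by rewrite -[true]/(~~ false) psi_flip e.
Qed.

Lemma psi_snd g m : (psi false false g m).2 = m.2.
Proof.
have := equivariant gen (psiM false false) (phi := fun _ => 1 : {perm bool}) (mu := snd).
move=> H; rewrite H ?perm1 //; first by move=> ? ?; rewrite mulg1.
move=> i q i_n; rewrite psiE // model2 // perm1 /shift.
by do 2?case: ifP; rewrite addbF.
Qed.

Section Noncyclic.
Variables (T : finType) (phi : G -> {perm T}) (p : T).
Hypothesis phiM : group_hom phi.
Hypothesis tr : transitive phi p.
Hypothesis noncyc : phi (b 0) <> phi (b 1%N).
Hypothesis T2n : #|T| <= 2 * n.

Lemma noncyclic_labelling : exists lam, labelling n (fun i => phi (b i)) lam.
Proof.
have n2 : 2 < n by lia.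
have [s' s'E [y cyc]] := artin_cyclic n2 (artin_hom phiM).
have [||lam [l1 l2]] := @labelling_upto_2n T n s' y cyc n7 _ _ T2n.
- move=> Z Z0 st; apply: (transitive_irreducible gen phiM tr Z0) => i q i_n qZ.
  by rewrite -s'E //; apply: st.
- by rewrite !s'E; [|lia|lia].
by exists lam; split=> // i q i_n; rewrite -s'E // l2.
Qed.

(** The coordinates strand_pt present T as the model itself when the fibres have
    two points, and as its quotient by the bits when they have one. In the
    first case (al, be) = (0, 0) is impossible, because T would fall apart into
    the two values of the bit. *)
Lemma classify_noncyclic : exists al be (l : 'I_n),
  (forall g, phi g p = p <-> psi al be g (l, false) = (l, false)) /\
  (#|T| = n /\ al || be = false \/ #|T| = (2 * n)%N /\ al || be).
Proof.
have [lam lab] := noncyclic_labelling.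
have n0 : 0 < n by lia. have n2 : 2 < n by lia. have n3 : 3 < n by lia.
pose s i := phi (b i); have arts : artin n s := artin_hom phiM.
have irr := transitive_irreducible gen phiM tr.
have T0 : 0 < #|T| by apply/card_gt0P; exists p.
have cT := labelling_card n0 irr lab T0.
pose F := [set q | lam q == 0].
have F12 : #|F| = 1%N \/ #|F| = 2 by move: cT T0 T2n; rewrite -/F; nia.
have [p0 [p1 [FE F1]]] : exists p0 p1, F = [set p0; p1] /\ (#|F| = 1%N <-> p0 = p1).
  case: F12 => cF; have := cF.
    by move=> /eqP/cards1P[q FE]; exists q, q; rewrite FE setUid cards1.
  by move=> /eqP/cards2P[q [r [ne FE]]]; exists q, r; rewrite FE cards2 ne; split=> //; split=> // e; rewrite e eqxx in ne.
have fib q : (lam q == 0) = (q == p0) || (q == p1).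
  by move/setP: FE => /(_ q); rewrite !inE.
pose al := far_twist s p0; pose be := square_twist s p0.
pose mu' (m : 'I_n * bool) := strand_pt s p0 p1 m.1 m.2.
have eqv g m : mu' (psi al be g m) = phi g (mu' m).
  apply: (equivariant gen) => // i q i_n; rewrite psiE //.
  exact: (strand_pt_model n2 arts lab fib).
have [e pE] := strand_pt_surj n2 lab fib p.
have lamn : lam p < n by case: lab.
pose l := Ordinal lamn.
have stab g : phi g p = p <->
    (psi al be g (l, e)).1 = l /\ fiber_pt p0 p1 (psi al be g (l, e)).2 = fiber_pt p0 p1 e.
  have -> : p = mu' (l, e) by [].
  rewrite -eqv /mu' /=; split=> [eq|[-> eq]].
    by have [/val_inj] := strand_pt_inj n2 lab fib (ltn_ord _) (ltn_ord l) eq.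
  have strand_pt_eq j e1 e2 : fiber_pt p0 p1 e1 = fiber_pt p0 p1 e2 -> strand_pt s p0 p1 j e1 = strand_pt s p0 p1 j e2.
    by move=> ee; elim: j => //= j ->.
  exact: strand_pt_eq.
case: F12 => cF; last first.
  have ne01 : p0 <> p1 by move/F1; rewrite cF.
  have pt_inj e1 e2 : fiber_pt p0 p1 e1 = fiber_pt p0 p1 e2 -> e1 = e2.
    by case: e1 e2 => [] [] //= h; case: ne01.
  exists al, be, l; split=> [g|]; last first.
    right; rewrite cT -/F cF mulnC; split=> //.
    apply: contraT; rewrite negb_or => /andP[/negbTE al0 /negbTE be0].
    pose Z := [set mu' (k, false) | k : 'I_n].
    have ZT : Z = [set: T].
      apply: irr => [|i _ i_n /imsetP[k _ ->]].
        by apply/set0Pn; exists (mu' (l, false)); apply: imset_f.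
      rewrite -eqv; case ek: (psi al be (b i) (k, false)) => [k' e'].
      have := psi_snd (b i) (k, false); rewrite -{1}al0 -{1}be0 ek /= => ->.
      exact: imset_f.
    have : mu' (Ordinal n0, true) \in Z by rewrite ZT inE.
    move=> /imsetP[k _ /(strand_pt_inj n2 lab fib (ltn_ord _) (ltn_ord _))[_ /pt_inj]].
    by [].
  rewrite stab -(psi_fix al be g l e); case: (psi _ _ _ _) => l' e' /=; split.
    by case=> -> /pt_inj ->.
  by case=> -> ->.
have e01 : p0 = p1 by apply/F1.
have ptc e1 e2 : fiber_pt p0 p1 e1 = fiber_pt p0 p1 e2 by rewrite /fiber_pt -e01 !if_same.
have shift0 (h : {perm T}) : lam (h p0) = 0 -> (h p0 != p0) = false.
  by move/eqP; rewrite fib -e01 orbb => /eqP ->; rewrite eqxx.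
have al0 : al = false.
  apply: shift0; have [_ H] := lab.
  have lp0 : lam p0 = 0 by apply/eqP; rewrite fib eqxx.
  by rewrite /s H ?lp0 //; lia.
have be0 : be = false.
  apply: shift0; have [_ H] := lab.
  have lp0 : lam p0 = 0 by apply/eqP; rewrite fib eqxx.
  by rewrite permM /s !H ?lp0 //; lia.
exists al, be, l; split=> [g|]; last by left; rewrite cT -/F cF muln1 al0 be0.
rewrite stab -(psi_fix al be g l e); split=> [[e1 _]|->//].
have e2 : (psi al be g (l, e)).2 = e by rewrite al0 be0 psi_snd.
by move: e1 e2; case: (psi _ _ _ _) => l' e' /= -> ->.
Qed.

End Noncyclic.

End Classify.

Definition rotation k : {perm 'I_k} := perm (@ordS_inj k).

Section CyclicAction.
Variables (G : groupType) (n : nat) (b : nat -> G).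
Hypothesis gen : generated_by n b.
Variables (k : nat) (cy : G -> {perm 'I_k}).
Hypothesis cyM : group_hom cy.
Hypothesis cyE : forall i, i.+1 < n -> cy (b i) = rotation k.

(** The common value of the generators is transitive, hence a cycle of length k. *)
Lemma classify_cyclic (T : finType) (phi : G -> {perm T}) (p : T) (o : 'I_k) :
  group_hom phi -> transitive phi p -> #|T| = k -> o = 0 :> nat ->
  (forall i, i.+1 < n -> phi (b i) = phi (b 0)) ->
  forall g, phi g p = p <-> cy g o = o.
Proof.
move=> phiM tr cT o0 const g.
pose x := phi (b 0).
have orbT : porbit x p = [set: T].
  apply: (transitive_irreducible gen phiM tr) => [|i q i_n qx].
    by apply/set0Pn; exists p; apply: porbit_id.
  by rewrite const // -/x; move: qx; rewrite -!eq_porbit_mem -(porbit_perm x 1%N q).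
have corb : #|porbit x p| = k by rewrite orbT cardsT.
pose mu (i : 'I_k) := (x ^+ i) p.
have muS i : mu (ordS i) = x (mu i).
  rewrite /mu -permM -expgSr /=; have [lt|ge] := ltnP i.+1 k; first by rewrite modn_small.
  have e : i.+1 = k by have := ltn_ord i; lia.
  by rewrite e modnn expg0 perm1 permX -corb iter_porbit.
have mu_inj : injective mu.
  have muT : mu @: [set: 'I_k] = [set: T].
    apply/setP => q; rewrite !inE; have : q \in porbit x p by rewrite orbT.
    rewrite porbit_traject => /trajectP[i]; rewrite corb => ik ->.
    by apply/imsetP; exists (Ordinal ik); rewrite // /mu permX.
  have : {in [set: 'I_k] &, injective mu}.
    by apply/imset_injP; rewrite muT !cardsT cT card_ord.
  by move=> H i j; apply: H; rewrite inE.
have eqv h m : mu (cy h m) = phi h (mu m).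
  apply: (equivariant gen) => // i q i_n.
  by rewrite cyE // permE muS const.
have po : p = mu o by rewrite /mu o0 expg0 perm1.
rewrite po -eqv; split=> [/mu_inj //|-> //].
Qed.

Lemma cyc_trivial i j : i.+1 < n -> j.+1 < n -> forall o, cy (b i * (b j)^-1) o = o.
Proof.
by move=> i_n jn o; rewrite cyM (group_homV _ cyM) !cyE // mulgV perm1.
Qed.

Lemma cyc_reach (Z : {set 'I_k}) o : 1 < n ->
  (forall i q, i.+1 < n -> q \in Z -> cy (b i) q \in Z) -> o \in Z -> o = 0 :> nat ->
  Z = [set: 'I_k].
Proof.
move=> n1 st oZ o0; apply/setP => q; rewrite inE.
case: q => l lk; elim: l lk => [|l IH] lk.
  by have -> : Ordinal lk = o by apply: val_inj.
have := st 0 _ n1 (IH (ltnW lk)); rewrite cyE // permE.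
by rewrite (_ : ordS _ = Ordinal lk) //; apply: val_inj; rewrite /= modn_small.
Qed.

End CyclicAction.

Section Separate.
Variables (G : groupType) (n : nat) (b : nat -> G).
Hypothesis n7 : 6 < n.
Variable psi : bool -> bool -> G -> {perm 'I_n * bool}.
Hypothesis psiM : forall al be, group_hom (psi al be).
Hypothesis psiE : forall al be i, i.+1 < n -> psi al be (b i) = model n al be i.

Definition touches i l := (i == l) || (i.+1 == l).

Lemma psi_off al be i (l : 'I_n) e : i.+1 < n -> ~~ touches i l ->
  psi al be (b i) (l, e) = (l, e (+) al).
Proof.
rewrite /touches negb_or => i_n /andP[h1 h2]; rewrite psiE //; apply: model_eq => /=.
  by rewrite model1 //= /adj_swap eq_sym (negbTE h1) eq_sym (negbTE h2).
by rewrite model2 //= /shift eq_sym (negbTE h1) eq_sym (negbTE h2).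
Qed.

Lemma psi_div_off al be i j (l : 'I_n) e : i.+1 < n -> j.+1 < n ->
  ~~ touches i l -> ~~ touches j l -> psi al be (b i * (b j)^-1) (l, e) = (l, e).
Proof.
move=> i_n jn il jl; rewrite psiM permM (group_homV _ (psiM _ _)) psi_off //.
by apply: (@perm_inj _ (psi al be (b j))); rewrite permKV psi_off.
Qed.

Lemma psi_div_on al be i j (l : 'I_n) e : i.+1 < n -> j.+1 < n ->
  touches i l -> ~~ touches j l -> psi al be (b i * (b j)^-1) (l, e) <> (l, e).
Proof.
move=> i_n jn il jl; rewrite psiM permM (group_homV _ (psiM _ _)) => eq.
have : psi al be (b i) (l, e) = psi al be (b j) (l, e) by rewrite -{2}eq permKV.
rewrite (psi_off _ _ _ jn jl) psiE // => /(congr1 (fun m : 'I_n * bool => nat_of_ord m.1)).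
rewrite model1 //= /adj_swap; move: il; rewrite /touches eq_sym.
by case: eqP => [->|_] /=; [lia|rewrite eq_sym; case: eqP => //; lia].
Qed.

Lemma psi_square al be i (l : 'I_n) e : i.+1 < n -> touches i l ->
  psi al be (b i * b i) (l, e) = (l, e (+) be).
Proof.
move=> i_n il; rewrite psiM permM !psiE //; apply: model_eq => /=.
  by rewrite !model1 //= adj_swapK.
rewrite !model2 // model1 //= /shift /adj_swap; move: il; rewrite /touches.
case: (i =P l) => [<-|ne] /=; first by rewrite eqxx; case: eqP => [|_]; [lia|rewrite eqxx addbF].
move/eqP => <-; have -> : (i.+1 == i) = false by lia.
by rewrite eqxx eqxx addbF.
Qed.

Lemma off_exists (l l' : 'I_n) : exists2 j, j.+1 < n & ~~ touches j l && ~~ touches j l'.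
Proof.
rewrite /touches; have ll := ltn_ord l; have ll' := ltn_ord l'.
suff : exists j, (j < 5) && (~~ touches j l && ~~ touches j l').
  by case=> j /andP[j5 h]; exists j => //; lia.
have [j|] := boolP [exists j : 'I_5, ~~ touches j l && ~~ touches j l'].
  by case/existsP: j => j h; exists j; rewrite ltn_ord.
rewrite negb_exists => /forallP no.
have h0 := no (Ordinal (isT : 0 < 5)); have h1 := no (Ordinal (isT : 1 < 5)).
have h2 := no (Ordinal (isT : 2 < 5)); have h3 := no (Ordinal (isT : 3 < 5)).
have h4 := no (Ordinal (isT : 4 < 5)).
by move: h0 h1 h2 h3 h4; rewrite /touches /=; lia.
Qed.

(** The quotient of two generators fixes a strand that neither of them touches,
    and moves a strand that exactly one of them touches. *)
Lemma separate_labels (l l' : 'I_n) : l != l' -> exists g : G,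
  (forall al be, psi al be g (l, false) = (l, false)) /\
  (forall al be, psi al be g (l', false) <> (l', false)) \/
  (forall al be, psi al be g (l', false) = (l', false)) /\
  (forall al be, psi al be g (l, false) <> (l, false)).
Proof.
move=> ne; have [j jn /andP[jl jl']] := off_exists l l'.
have [i i_n t] : exists2 i, i.+1 < n & touches i l != touches i l'.
  wlog lt : l l' {ne j jn jl jl'} / l < l' => [H|].
    have := ne; rewrite -val_eqE neq_ltn => /orP[/H //|/H[i i_n]].
    by rewrite eq_sym; exists i.
  have ll' := ltn_ord l'; rewrite /touches.
  have [l0|l0] := posnP l; last by exists l.-1; lia.
  by have [e|e] := eqVneq (l' : nat) n.-1; [exists n.-2|exists l']; lia.
exists (b i * (b j)^-1); case: (boolP (touches i l)) t => il; case: (boolP (touches i l')) => il' // _.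
  by right; split=> al be; [apply: psi_div_off|apply: psi_div_on].
by left; split=> al be; [apply: psi_div_off|apply: psi_div_on].
Qed.

(** The generators away from l detect al, the squares of those at l detect be. *)
Lemma separate_params al be al' be' (l : 'I_n) :
  (forall g, psi al be g (l, false) = (l, false) <-> psi al' be' g (l, false) = (l, false)) ->
  al = al' /\ be = be'.
Proof.
move=> H; have [j jn /andP[jl _]] := off_exists l l.
have same (c c' : bool) : ((l, c) = (l, false) <-> (l, c') = (l, false)) -> c = c'.
  by case: c c' => [] [] // [h1 h2]; [have := h2 erefl|have := h1 erefl].
split; apply: same.
  by have := H (b j); rewrite !psi_off.
have [i i_n il] : exists2 i, i.+1 < n & touches i l.
  have ll := ltn_ord l; rewrite /touches.
  by have [l0|l0] := posnP l; [exists 0|exists l.-1]; lia.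
by have := H (b i * b i); rewrite !psi_square.
Qed.

Lemma cyclic_neq al be (l : 'I_n) k (cy : G -> {perm 'I_k}) (o : 'I_k) :
  group_hom cy -> (forall i, i.+1 < n -> cy (b i) = rotation k) ->
  ~ (forall g, psi al be g (l, false) = (l, false) <-> cy g o = o).
Proof.
move=> cyM cyE H; have [j jn /andP[jl _]] := off_exists l l.
have [i i_n il] : exists2 i, i.+1 < n & touches i l.
  have ll := ltn_ord l; rewrite /touches.
  by have [l0|l0] := posnP l; [exists 0|exists l.-1]; lia.
by apply: (psi_div_on i_n jn il jl); apply/H; apply: (cyc_trivial cyM cyE).
Qed.

End Separate.

(** * The presentation on two generators *)

Section Presentation.
Variable G : groupType.
Implicit Types (x y : G).

(** The power telescopes into the product of the rotates of x. *)
Lemma prod_conj_gprod x y m :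
  (y * x) ^+ m = gprod (fun i => x ^ (y^-1 ^+ i)) 1 m.+1 * y ^+ m.
Proof.
elim: m => [|m IH]; first by rewrite /gprod big_geq // expg0 mulg1.
rewrite expgSr IH (@gprodS _ _ 1%N m.+1) // -!mulgA; congr (_ * _).
by rewrite expVgn invgK mulVg mulg1 mulgA -expgSr.
Qed.

Lemma conj_gprod x y m k : gprod (fun i => x ^ (y^-1 ^+ i.+1)) m k ^ y =
  gprod (fun i => x ^ (y^-1 ^+ i)) m k.
Proof.
rewrite /gprod conjg_prod; apply: eq_bigr => i _.
by rewrite -conjgM expgSr mulgVK.
Qed.

Definition rot_gen x y i := x ^ (y^-1 ^+ i).

Lemma rot_genS x y i : y * rot_gen x y i = rot_gen x y i.+1 * y.
Proof.
rewrite /rot_gen expgSr conjgM; move: (x ^ _) => z.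
by rewrite conjgE invgK -!mulgA mulVg mulg1.
Qed.

Section FromPresentation.
Variables (x y : G) (n : nat).
Hypothesis n3 : 2 < n.
Hypothesis rel : y ^+ n = (y * x) ^+ n.-1.
Hypothesis com : forall i, 2 <= i <= n./2 -> commute (rot_gen x y i) x.

Local Notation s := (rot_gen x y).

Lemma y_eq_gprod1 : y = gprod s 1 n.
Proof.
apply: (mulIg (y ^+ n.-1)); rewrite -expgS prednK; last by lia.
by rewrite rel prod_conj_gprod prednK //; lia.
Qed.

Lemma y_eq_gprod : y = gprod s 0 n.-1.
Proof.
have e : gprod s 1 n = gprod (fun i => s i.+1) 0 n.-1 by rewrite /gprod big_add1.
have yy : y ^ y = y by rewrite conjgE mulKg.
by rewrite -{1}yy {1}y_eq_gprod1 e conj_gprod.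
Qed.

Lemma y_central : commute (y ^+ n) x.
Proof.
have cyx : commute (y ^+ n) (y * x) by rewrite rel; apply/commute_sym/commuteX.
have cy : commute (y ^+ n) y by apply/commute_sym/commuteX.
have -> : x = y^-1 * (y * x) by rewrite mulKg.
by apply: commuteM => //; apply: commuteV.
Qed.

Lemma rot_gen_per i : s (i + n)%N = s i.
Proof.
rewrite /rot_gen addnC expgnDr conjgM; congr (_ ^ _).
apply/conjg_fixP/commgP; rewrite expVgn; apply: commuteV; exact/commute_sym/y_central.
Qed.

Lemma rot_gen_conj i j : s (i + j)%N = s i ^ (y^-1 ^+ j).
Proof. by rewrite /rot_gen expgnDr conjgM. Qed.

Lemma commute_conj (a c z : G) : commute a c -> commute (a ^ z) (c ^ z).
Proof. by move=> ac; rewrite /commute -!conjMg ac. Qed.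

(** The relators reach only distances up to n / 2; a rotation by d exchanges the
    distances d and n - d. *)
Lemma rot_gen_com d : 2 <= d -> d + 2 <= n -> commute x (s d).
Proof.
have s0 : s 0 = x by rewrite /rot_gen expg0 conjg1.
move=> d2 dn; have [le|gt] := leqP d n./2.
  by apply/commute_sym/com; rewrite d2.
have c : commute (s (n - d)) (s 0).
  by rewrite s0; apply: com; move: gt; rewrite -divn2; lia.
have := commute_conj (y^-1 ^+ d) c; rewrite -!rot_gen_conj subnK; last by lia.
by rewrite add0n -[n]add0n rot_gen_per s0.
Qed.

(** By telescoping, the first relator says that y is the product of the rotates
    of x from the second on; rotating back, y is the product of the first
    n - 1 of them. Expanding both sides of y * s 0 = s 1 * y then gives the
    braid relation. *)
Lemma artin_rot_gen : artin n s.
Proof.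
have s0 : s 0 = x by rewrite /rot_gen expg0 conjg1.
split=> [i j ij jn|i i_n].
  have -> : j = (j - i + i)%N by lia.
  have {1 2}-> : i = (0 + i)%N by [].
  rewrite !rot_gen_conj; apply: commute_conj; rewrite s0.
  by apply: rot_gen_com; lia.
have brd : s 0 * s 1%N * s 0 = s 1%N * s 0 * s 1%N.
  pose w := gprod s 2 n.-1.
  have yE : y = s 0 * s 1%N * w.
    rewrite {1}y_eq_gprod -mulgA /gprod big_ltn; last by lia.
    by congr (_ * _); rewrite big_ltn //; lia.
  have w0 : w * s 0 = s 0 * w.
    apply: gprod_commute => j jn; rewrite s0; apply/commute_sym/rot_gen_com; lia.
  have ys : y * s 0 = s 1%N * y by apply: rot_genS.
  move: (s 0) (s 1%N) w yE w0 ys => a c w -> w0 ys; apply: (mulIg w).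
  by rewrite -!mulgA -w0 !mulgA ys !mulgA.
have -> : i.+1 = (1 + i)%N by [].
have {1 3 5}-> : i = (0 + i)%N by [].
by rewrite !rot_gen_conj -!conjMg brd.
Qed.

End FromPresentation.

Section ToPresentation.
Variables (s : nat -> G) (n : nat).
Hypothesis n3 : 2 < n.
Hypothesis art : artin n s.
Local Notation x := (s 0).
Local Notation y := (gprod s 0 n.-1).

Lemma artin_rot_gen_eq i : i.+1 < n -> rot_gen x y i = s i.
Proof.
move=> i_n; rewrite /rot_gen conjgE expVgn invgK mulgA artin_rotate_iter ?add0n //.
by rewrite mulgK.
Qed.

Lemma artin_presentation_com i : 2 <= i <= n./2 -> commute (rot_gen x y i) x.
Proof.
case: art => com _ i2; rewrite artin_rot_gen_eq; last by rewrite -divn2 in i2; lia.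
by apply/commute_sym/com; rewrite -divn2 in i2; lia.
Qed.

(** After telescoping, the claim is that the last generator followed by its
    successor on the circle obeys artin_rotate_last. *)
Lemma artin_presentation_rel : y ^+ n = (y * x) ^+ n.-1.
Proof.
have n1 : n.-1.+1 = n by rewrite prednK //; lia.
have yn : y ^+ n = y * y ^+ n.-1 by rewrite -expgS n1.
rewrite prod_conj_gprod n1 yn; congr (_ * _).
have last : gprod (rot_gen x y) 1 n = gprod (rot_gen x y) 1 n.-1 * rot_gen x y n.-1.
  by rewrite -gprodS ?n1 //; lia.
have init : gprod (rot_gen x y) 1 n.-1 = gprod s 1 n.-1.
  rewrite /gprod big_nat_cond [RHS]big_nat_cond; apply: eq_bigr => i.
  by rewrite andbT => i_n; apply: artin_rot_gen_eq; lia.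
have final : rot_gen x y n.-1 * y = y * s n.-2.
  transitivity (rot_gen x y n.-2.+1 * y).
    by congr (rot_gen _ _ _ * _); lia.
  by rewrite -rot_genS artin_rot_gen_eq //; lia.
have yE : x * gprod s 1 n.-1 = y by rewrite /gprod [RHS]big_ltn //; lia.
apply: (mulIg y); apply: (mulgI x).
rewrite -/(rot_gen x y) last init -(mulgA (gprod s 1 n.-1)) final.
by rewrite !(mulgA x) yE mulgA artin_rotate_last // mulgA.
Qed.

End ToPresentation.
End Presentation.

(** * Counting the subgroups *)

From mathcomp Require Import boolp classical_sets functions cardinality.

Local Open Scope classical_set_scope.
Local Open Scope card_scope.
Local Open Scope group_scope.

Lemma group_closedP (G : groupType) (H : set G) :
  group_closed (mem H) <-> H 1 /\ forall g h, H g -> H h -> H (g * h^-1).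
Proof.
split=> [[H1 HD]|[H1 HD]]; split.
- exact: (set_mem H1).
- by move=> g h Hg Hh; exact: (set_mem (HD g h (mem_set Hg) (mem_set Hh))).
- exact: (mem_set H1).
- by move=> g h Hg Hh; exact: (mem_set (HD _ _ (set_mem Hg) (set_mem Hh))).
Qed.

Lemma card_range_fin (F : finType) (U : Type) (f : F -> U) (A : set U) :
  injective f -> A = range f -> A #= `I_#|F|.
Proof.
move=> fi ->; apply: (card_eq_trans (inj_card_eq (in2W fi))).
apply/card_set_bijP; exists (fun x => nat_of_ord (enum_rank x)); split.
- by move=> x _ /=; apply: ltn_ord.
- by move=> x y _ _ /val_inj /enum_rank_inj.
- by move=> i /= ik; exists (enum_val (Ordinal ik)) => //; rewrite enum_valK.
Qed.

Section Stabilizer.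
Variables (G : groupType) (M : finType) (phi : G -> {perm M}) (p : M).
Hypothesis phiM : group_hom phi.

Definition stabilizer : set G := [set g | phi g p = p].

Lemma stabilizer_group : group_closed (mem stabilizer).
Proof.
apply/group_closedP; split=> [|g h gp hp]; rewrite /stabilizer /=.
  by rewrite group_hom1 // perm1.
by rewrite phiM permM gp group_homV //; apply: (@perm_inj _ (phi h)); rewrite permKV hp.
Qed.

Lemma stabilizer_index (O : {pred M}) :
  (forall q, reflect (exists g, phi g p = q) (q \in O)) ->
  has_index stabilizer #|O|.
Proof.
move=> OP.
pose f (u : {x | x \in O}) : set G := [set g | phi g^-1 p = val u].
have cosetE g : left_coset stabilizer g = [set h | phi h^-1 p = phi g^-1 p].
  apply/seteqP; split=> [_ [h hp <-]|h /= e].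
    rewrite /= invMg phiM permM; congr (phi _ _).
    by apply: (@perm_inj _ (phi h)); rewrite group_homV // permKV hp.
  exists (g^-1 * h); last by rewrite mulKVg.
  by rewrite /stabilizer /= phiM permM -e group_homV // permKV.
rewrite /has_index -card_sig; apply: (@card_range_fin _ _ f).
  move=> u v fuv; apply: val_inj.
  have [g gu] := elimT (OP (val u)) (valP u).
  have : f u g^-1 by rewrite /f /= invgK.
  by rewrite fuv /f /= invgK gu.
apply/seteqP; split=> [_ [g _ <-]|_ [u _ <-]].
  have gO : phi g^-1 p \in O by apply/OP; exists g^-1.
  by exists (exist (fun x => x \in O) _ gO) => //; rewrite cosetE.
have [g gu] := elimT (OP (val u)) (valP u).
by exists g^-1 => //; rewrite cosetE invgK gu.
Qed.

End Stabilizer.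

(** The element g sends h H to g^-1 h H: the inverse is there because
    permutations compose from left to right. *)
Lemma coset_action (G : groupType) (H : set G) k : group_closed (mem H) ->
  has_index H k -> exists (phi : G -> {perm 'I_k}) (p : 'I_k),
    [/\ group_hom phi, transitive phi p & H = stabilizer phi p].
Proof.
move=> /group_closedP[H1 HD] /card_set_bijP[f [f_fun f_inj f_surj]].
have HV g : H g -> H g^-1 by move=> Hg; rewrite -[g^-1]mul1g; apply: HD.
have HM g h : H g -> H h -> H (g * h) by move=> Hg /HV Hh; rewrite -[h]invgK; apply: HD.
have fk g : f (left_coset H g) < k by apply: f_fun; exists g.
pose idx g := Ordinal (fk g).
have idxP g h : idx g = idx h <-> H (g^-1 * h).
  split=> [/(congr1 val) /= e|gh].
    have mr a : left_coset H a \in range (left_coset H) by apply/mem_set; exists a.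
    have : left_coset H h h by exists 1 => //; rewrite mulg1.
    rewrite -(f_inj _ _ (mr g) (mr h) e).
    by case=> x Hx <-; rewrite mulKg.
  apply: val_inj => /=; congr f; apply/seteqP; split=> _ [x Hx <-].
    exists (h^-1 * g * x); last by rewrite !mulgA mulgV mul1g.
    by apply: HM => //; rewrite -[_ * g]invgK; apply: HV; rewrite invMg invgK.
  by exists (g^-1 * h * x); [apply: HM|rewrite !mulgA mulgV mul1g].
have idx_surj i : exists g, idx g = i.
  have [_ [g _ <-] fi] := f_surj i (ltn_ord i).
  by exists g; apply: val_inj.
pose r i := sval (cid (idx_surj i)).
have rK i : idx (r i) = i by rewrite /r; case: cid.
pose act g i := idx (g^-1 * r i).
have actE g h : act g (idx h) = idx (g^-1 * h).
  apply/idxP; rewrite invMg invgK mulgA mulgK.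
  by apply/idxP; rewrite rK.
have actK g : cancel (act g) (act g^-1).
  by move=> i; rewrite -[i]rK !actE invgK mulKVg.
pose phi g : {perm 'I_k} := perm (can_inj (actK g)).
have phiE g h : phi g (idx h) = idx (g^-1 * h) by rewrite permE actE.
exists phi, (idx 1); split.
- by move=> g h; apply/permP => i; rewrite -[i]rK permM !phiE invMg mulgA.
- by move=> i; exists (r i)^-1; rewrite phiE invgK mulg1 rK.
apply/seteqP; split=> g; rewrite /stabilizer /= phiE mulg1.
  by move=> Hg; apply/idxP; rewrite invgK mulg1.
by move/idxP; rewrite invgK mulg1.
Qed.

Section Eval.
Variables (K : groupType) (x y : K).

Definition eval_letter (l : bool * bool) : K :=
  let a := if l.1 then y else x in if l.2 then a^-1 else a.

(** The value of a word when the two generators are sent to x and y. *)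
Definition eval (w : word bool) : K := \prod_(l <- w) eval_letter l.

Lemma eval_cat u v : eval (u ++ v) = eval u * eval v.
Proof. exact: big_cat. Qed.

Lemma eval_winv w : eval (winv w) = (eval w)^-1.
Proof.
elim: w => [|[a e] w IH]; first by rewrite /eval big_nil invg1.
rewrite -cat1s winv_cat !eval_cat invMg IH; congr (_ * _).
by rewrite /eval !big_seq1; case: e => //=; rewrite /eval_letter /= invgK.
Qed.

Lemma eval_wexp w m : eval (wexp w m) = eval w ^+ m.
Proof.
elim: m => [|m IH]; first by rewrite /eval big_nil.
by rewrite /wexp iterS eval_cat -/(wexp w m) IH expgS.
Qed.

Lemma eval_x : eval braid_x = x.
Proof. by rewrite /eval big_seq1. Qed.

Lemma eval_y : eval braid_y = y.
Proof. by rewrite /eval big_seq1. Qed.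

Lemma eval_word_eq (R : set (word bool)) u v :
  (forall r, R r -> eval r = 1) -> word_eq R u v -> eval u = eval v.
Proof.
move=> R1; elim=> //.
- by move=> ? ? ? _ -> _ ->.
- by move=> *; rewrite !eval_cat; congr (_ * _).
- move=> a e; rewrite /eval big_cons big_seq1 big_nil /eval_letter /=.
  by case: e => /=; rewrite ?mulVg ?mulgV.
- by move=> r /R1 ->; rewrite /eval big_nil.
Qed.

Lemma eval_relators n :
  (forall r, braid_relators n r -> eval r = 1) <->
  y ^+ n = (y * x) ^+ n.-1 /\ forall i, 2 <= i <= n./2 -> commute (rot_gen x y i) x.
Proof.
have cE i : eval (wcomm (wconj (wexp braid_y i) braid_x) braid_x) =
    rot_gen x y i * x * (rot_gen x y i)^-1 * x^-1.
  rewrite /wcomm /wconj !eval_cat !eval_winv !eval_cat !eval_winv eval_wexp eval_x eval_y.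
  by rewrite /rot_gen conjgE expVgn invgK !mulgA.
split=> [H|[H1 H2]].
  split=> [|i i2].
    have := H _ (or_introl erefl); rewrite eval_cat eval_winv !eval_wexp eval_cat eval_x eval_y.
    exact: divg1_eq.
  have := H _ (or_intror (ex_intro2 _ _ i i2 erefl)); rewrite cE => /divg1_eq.
  by move=> e; apply: (mulIg (rot_gen x y i)^-1); rewrite e mulgK.
move=> r [->|[i /= i2 <-]].
  by rewrite eval_cat eval_winv !eval_wexp eval_cat eval_x eval_y H1 mulgV.
by rewrite cE H2 // mulgK mulgV.
Qed.

End Eval.

Section BraidGroup.
Variable n : nat.
Hypothesis n3 : 2 < n.
Local Notation G := (braid_group n).
Local Notation cls := (@pres_class bool (braid_relators n)).

Definition class_x : G := cls braid_x.
Definition class_y : G := cls braid_y.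

Lemma clsM u v : (cls u : G) * cls v = cls (u ++ v).
Proof. exact: pres_mulE. Qed.

Lemma clsV u : (cls u : G)^-1 = cls (winv u).
Proof. exact: pres_invE. Qed.

Lemma cls_eval w : cls w = eval class_x class_y w.
Proof.
elim: w => [|[a e] w IH]; first by rewrite /eval big_nil.
rewrite -cat1s eval_cat -IH -clsM; congr (_ * _).
by rewrite /eval big_seq1 /eval_letter /=; case: a e => [] [] //=; rewrite clsV.
Qed.

Lemma braid_group_relations : class_y ^+ n = (class_y * class_x) ^+ n.-1 /\
  forall i, 2 <= i <= n./2 -> commute (rot_gen class_x class_y i) class_x.
Proof.
apply/eval_relators => r Rr; rewrite -cls_eval.
by apply/(pres_classP _ r [::])/word_eq_rel.
Qed.

Definition sigma (i : nat) : G := rot_gen class_x class_y i.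

Lemma sigma_artin : artin n sigma.
Proof. by case: braid_group_relations => r1 r2; apply: artin_rot_gen. Qed.

Lemma class_y_sigma : class_y = gprod sigma 0 n.-1.
Proof. by case: braid_group_relations => r1 r2; apply: y_eq_gprod. Qed.

Lemma class_x_sigma : class_x = sigma 0.
Proof. by rewrite /sigma /rot_gen expg0 conjg1. Qed.

Lemma sigma_generates : generated_by n sigma.
Proof.
move=> P P1 PM PV g.
have Pgx h : P h -> P (class_x * h) by rewrite class_x_sigma; apply: PM; lia.
have Pgxv h : P h -> P (class_x^-1 * h) by rewrite class_x_sigma; apply: PV; lia.
have [Pgy Pgyv] : (forall h, P h -> P (class_y * h)) /\ (forall h, P h -> P (class_y^-1 * h)).
  have : forall m, m < n -> (forall h, P h -> P (gprod sigma 0 m * h)) /\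
      (forall h, P h -> P ((gprod sigma 0 m)^-1 * h)).
    elim=> [|m IH] mn; first by rewrite /gprod big_geq // invg1; split=> h; rewrite mul1g.
    have [IH1 IH2] := IH (ltnW mn); rewrite gprodS //; split=> h Ph.
      by rewrite -mulgA; apply/IH1/PM.
    by rewrite invMg -mulgA; apply: PV => //; apply: IH2.
  by rewrite class_y_sigma; apply; lia.
rewrite -(pres_reprK g) cls_eval; elim: (pres_repr g) => [|[a e] w IH].
  by rewrite /eval big_nil.
rewrite -cat1s eval_cat {1}/eval big_seq1 /eval_letter /=.
by case: a e => [] []; auto.
Qed.

Lemma braid_hom (K : groupType) (s : nat -> K) : artin n s ->
  exists2 f : G -> K, group_hom f & forall i, i.+1 < n -> f (sigma i) = s i.
Proof.
move=> art; pose x := s 0; pose y := gprod s 0 n.-1.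
have R1 : forall r, braid_relators n r -> eval x y r = 1.
  apply/eval_relators; split; first exact: artin_presentation_rel.
  exact: artin_presentation_com.
pose f (g : G) := eval x y (pres_repr g).
have f_cls w : f (cls w) = eval x y w.
  by apply: (eval_word_eq R1); apply: pres_classK.
have fM : group_hom f.
  move=> g h; rewrite -{1}(pres_reprK g) -{1}(pres_reprK h) [_ * _]clsM f_cls.
  exact: eval_cat.
exists f => // i i_n.
have fX g m : f (g ^+ m) = f g ^+ m.
  by elim: m => [|m IH]; rewrite ?expg0 ?group_hom1 // !expgS fM IH.
rewrite /sigma /rot_gen conjgE !fM group_homV // fX group_homV // !f_cls eval_x eval_y -conjgE.
exact: artin_rot_gen_eq.
Qed.

End BraidGroup.

Section Orbit.
Variables (G : groupType) (M : finType) (phi : G -> {perm M}) (p : M).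
Hypothesis phiM : group_hom phi.

Definition orbit_set : {set M} := finset (fun q => `[< exists g, phi g p = q >]).

Lemma orbit_setP q : reflect (exists g, phi g p = q) (q \in orbit_set).
Proof. by rewrite finset.inE; apply: asboolP. Qed.

Lemma orbit_set_base : p \in orbit_set.
Proof. by apply/orbit_setP; exists 1; rewrite group_hom1 // perm1. Qed.

Lemma orbit_set_stable g q : q \in orbit_set -> phi g q \in orbit_set.
Proof.
by move=> /orbit_setP[h <-]; apply/orbit_setP; exists (h * g); rewrite phiM permM.
Qed.

Lemma stabilizer_subgroup k : #|orbit_set| = k ->
  subgroups_of_index G k (stabilizer phi p).
Proof.
move=> <-; split; first exact: stabilizer_group.
exact: (stabilizer_index phiM orbit_setP).
Qed.

End Orbit.

Section Count.
Variable n : nat.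
Hypothesis n3 : 2 < n.
Local Notation G := (braid_group n).
Local Notation sg := (sigma n).

Section CyclicSubgroup.
Variables (k : nat) (k0 : 0 < k).

Lemma cyclic_hom_exists : exists2 cy : G -> {perm 'I_k}, group_hom cy &
  forall i, i.+1 < n -> cy (sg i) = rotation k.
Proof. by apply: (braid_hom n3). Qed.

Definition cyclic_hom := s2val (cid2 cyclic_hom_exists).

Lemma cyclic_homM : group_hom cyclic_hom.
Proof. exact: (s2valP (cid2 cyclic_hom_exists)). Qed.

Lemma cyclic_homE i : i.+1 < n -> cyclic_hom (sg i) = rotation k.
Proof. exact: (s2valP' (cid2 cyclic_hom_exists)). Qed.

Definition cyclic_subgroup : set G := stabilizer cyclic_hom (Ordinal k0).

Lemma cyclic_subgroup_index : subgroups_of_index G k cyclic_subgroup.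
Proof.
apply: (stabilizer_subgroup cyclic_homM).
rewrite (cyc_reach cyclic_homE (Z := orbit_set cyclic_hom (Ordinal k0)) (o := Ordinal k0)) //.
- by rewrite cardsT card_ord.
- by lia.
- by move=> i q _; apply: (orbit_set_stable cyclic_homM).
- exact: (orbit_set_base _ cyclic_homM).
Qed.

Lemma cyclic_subgroup_eq (phi : G -> {perm 'I_k}) p : group_hom phi -> transitive phi p ->
  (forall i, i.+1 < n -> phi (sg i) = phi (sg 0)) ->
  stabilizer phi p = cyclic_subgroup.
Proof.
move=> phiM tr const.
have H := classify_cyclic (sigma_generates n3) cyclic_homM cyclic_homE phiM tr (card_ord k)
  (erefl : Ordinal k0 = 0 :> nat) const.
by apply/seteqP; split=> g; rewrite /cyclic_subgroup /stabilizer /= => /H.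
Qed.

End CyclicSubgroup.

Lemma model_hom_exists al be : exists2 psi : G -> {perm 'I_n * bool}, group_hom psi &
  forall i, i.+1 < n -> psi (sg i) = model n al be i.
Proof. by apply: (braid_hom n3); apply: artin_model. Qed.

Definition model_hom al be := s2val (cid2 (model_hom_exists al be)).

Lemma model_homM al be : group_hom (model_hom al be).
Proof. exact: (s2valP (cid2 (model_hom_exists al be))). Qed.

Lemma model_homE al be i : i.+1 < n -> model_hom al be (sg i) = model n al be i.
Proof. exact: (s2valP' (cid2 (model_hom_exists al be))). Qed.

(** The bit false is a harmless choice, by psi_flip. *)
Definition strand_subgroup al be (l : 'I_n) : set G :=
  stabilizer (model_hom al be) (l, false).

(** Without twist the bit is an invariant, so the orbit has n points only. *)
Lemma strand_subgroup_index al be l : 6 < n ->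
  subgroups_of_index G (if al || be then 2 * n else n)%N (strand_subgroup al be l).
Proof.
move=> n7; apply: (stabilizer_subgroup (@model_homM al be)).
set Z := orbit_set _ _.
have st i q : i.+1 < n -> q \in Z -> model n al be i q \in Z.
  by move=> i_n qZ; rewrite -model_homE //; apply: (orbit_set_stable (@model_homM al be)).
have n4 : 3 < n by lia.
have lZ : (l, false) \in Z by apply: (orbit_set_base _ (@model_homM al be)).
have full : Z = finset.setTfor ('I_n * bool)%type -> #|Z| = (2 * n)%N.
  by move=> ->; rewrite cardsT card_prod card_ord card_bool mulnC.
case: (model_reach n4 st lZ) => [[reach ab]|[-> /full //]].
have [/ab/full //|] := boolP (al || be).
rewrite negb_or => /andP[/negbTE al0 /negbTE be0].
rewrite -[RHS]card_ord -(@card_imset _ _ (fun l' : 'I_n => (l', false))); last by move=> ? ? [].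
apply: eq_card => -[l' e]; apply/idP/imsetP => [/orbit_setP[g gq]|[l'' _ ->]]; last exact: reach.
exists l' => //; congr (_, _).
have := psi_snd (sigma_generates n3) model_homM model_homE g (l, false).
have -> : model_hom false false g (l, false) = (l', e) by rewrite -gq al0 be0.
by [].
Qed.

Lemma noncyclic_subgroup_eq k (phi : G -> {perm 'I_k}) p : 6 < n ->
  group_hom phi -> transitive phi p -> phi (sg 0) <> phi (sg 1%N) -> k <= 2 * n ->
  exists al be l, stabilizer phi p = strand_subgroup al be l /\
   (k = n /\ al || be = false \/ k = (2 * n)%N /\ al || be).
Proof.
move=> n7 phiM tr noncyc k2n.
have [|al [be [l [H1 H2]]]] := classify_noncyclic n7 (sigma_generates n3)
  (sigma_artin n3) model_homM model_homE phiM tr noncyc; first by rewrite card_ord.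
exists al, be, l; rewrite card_ord in H2; split=> //.
by apply/seteqP; split=> g; rewrite /strand_subgroup /stabilizer /= => /H1.
Qed.

Lemma subgroup_cases k (k0 : 0 < k) H : 6 < n -> k <= 2 * n -> subgroups_of_index G k H ->
  H = cyclic_subgroup k0 \/ exists al be l, H = strand_subgroup al be l /\
   (k = n /\ al || be = false \/ k = (2 * n)%N /\ al || be).
Proof.
move=> n7 k2n [Hg Hk]; have [phi [p [phiM tr ->]]] := coset_action Hg Hk.
have [e|/eqP ne] := eqVneq (phi (sg 0)) (phi (sg 1%N)); last first.
  by right; apply: noncyclic_subgroup_eq.
left; apply: cyclic_subgroup_eq => // i i_n.
exact: (artin_constant (artin_hom (sigma_artin n3) phiM)).
Qed.

Lemma only_cyclic k : 0 < k -> k < n /\ 4 < n \/ (6 < n /\ n < k /\ k < 2 * n) ->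
  subgroups_of_index G k #= `I_1.
Proof.
move=> k0 cases.
suff -> : subgroups_of_index G k = [set cyclic_subgroup k0] by exact: card_set1.
apply/seteqP; split=> [H HH|_ ->]; last exact: cyclic_subgroup_index.
case: cases => [[kn n5]|[n7 [nk k2n]]].
  case: HH => Hg Hk; have [phi [p [phiM tr ->]]] := coset_action Hg Hk.
  apply: cyclic_subgroup_eq => // i i_n.
  apply: (artin_constant_below n5 (artin_hom (sigma_artin n3) phiM)) => //.
  by rewrite card_ord.
case: (subgroup_cases k0 n7 (ltnW k2n) HH) => [//|[al [be [l [_ [[e _]|[e _]]]]]]]; lia.
Qed.

Lemma strand_subgroup_inj al be l al' be' l' : 6 < n ->
  strand_subgroup al be l = strand_subgroup al' be' l' -> [/\ l = l', al = al' & be = be'].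
Proof.
move=> n7 e.
have E g : model_hom al be g (l, false) = (l, false) <->
    model_hom al' be' g (l', false) = (l', false).
  have := congr1 (fun A : set G => A g) e; rewrite /strand_subgroup /stabilizer /= => eg.
  by rewrite eg.
have [el|ne] := eqVneq l l'; last first.
  have [g [[h1 h2]|[h1 h2]]] := separate_labels n7 model_homM model_homE ne.
    by case: (h2 al' be'); apply/E.
  by case: (h2 al be); apply/E.
by subst l'; have [-> ->] := separate_params n7 model_homM model_homE E.
Qed.

Lemma cyclic_strand_neq k (k0 : 0 < k) al be l : 6 < n ->
  cyclic_subgroup k0 <> strand_subgroup al be l.
Proof.
move=> n7 e.
apply: (@cyclic_neq _ _ _ n7 _ model_homM model_homE al be l _ _ (Ordinal k0) (@cyclic_homM k) (@cyclic_homE k)) => g.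
have := congr1 (fun A : set G => A g) e; rewrite /strand_subgroup /cyclic_subgroup /stabilizer /= => eg.
by rewrite eg.
Qed.

Lemma count_n : 6 < n -> subgroups_of_index G n #= `I_(n + 1).
Proof.
move=> n7; have n0 : 0 < n by lia.
pose f (o : option 'I_n) : set G :=
  if o is Some l then strand_subgroup false false l else cyclic_subgroup n0.
have -> : (n + 1)%N = #|{: option 'I_n}| by rewrite card_option card_ord addn1.
apply: (@card_range_fin _ _ f).
  move=> [l|] [l'|] //= e.
  - by have [->] := strand_subgroup_inj n7 e.
  - by case: (@cyclic_strand_neq _ n0 false false l n7).
  - by case: (@cyclic_strand_neq _ n0 false false l' n7).
apply/seteqP; split=> [H HH|_ [[l|] _ <-]].
- have n2n : n <= 2 * n by lia.
  case: (subgroup_cases n0 n7 n2n HH) => [->|[al [be [l [-> c]]]]]; first by exists None.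
  have [/negbT] : al || be = false by case: c => [[]|[]] //; lia.
  by rewrite negb_or => /andP[/negbTE -> /negbTE ->]; exists (Some l).
- exact: (strand_subgroup_index false false l n7).
- exact: cyclic_subgroup_index.
Qed.

Lemma count_2n : 6 < n -> subgroups_of_index G (2 * n) #= `I_(3 * n + 1).
Proof.
move=> n7; have n0 : 0 < 2 * n by lia.
pose f (o : option ('I_n * option bool)) : set G :=
  match o with
  | Some (l, Some be) => strand_subgroup true be l
  | Some (l, None) => strand_subgroup false true l
  | None => cyclic_subgroup n0
  end.
have -> : (3 * n + 1)%N = #|{: option ('I_n * option bool)}|.
  by rewrite card_option card_prod card_option card_ord card_bool addn1 mulnC.
apply: (@card_range_fin _ _ f).
  move=> [[l [be|]]|] [[l' [be'|]]|] //= e; try by have [-> ? ?] := strand_subgroup_inj n7 e; subst.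
  - by case: (@cyclic_strand_neq _ n0 true be l n7).
  - by case: (@cyclic_strand_neq _ n0 false true l n7).
  - by case: (@cyclic_strand_neq _ n0 true be' l' n7).
  - by case: (@cyclic_strand_neq _ n0 false true l' n7).
apply/seteqP; split=> [H HH|_ [[[l [be|]]|] _ <-]].
- case: (subgroup_cases n0 n7 (leqnn _) HH) => [->|[al [be [l [-> c]]]]]; first by exists None.
  have : al || be by case: c => [[]|[]] //; lia.
  case: al {c} => [_|/= ->]; first by exists (Some (l, Some be)).
  by exists (Some (l, None)).
- exact: (strand_subgroup_index true be l n7).
- exact: (strand_subgroup_index false true l n7).
- exact: cyclic_subgroup_index.
Qed.

End Count.

Local Close Scope group_scope.

Theorem corollary10p5 (n k : nat) (hn : 3 <= n) (hk : 1 <= k) :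
  [/\ (k < n /\ 4 < n) \/ (6 < n /\ n < k /\ k < 2 * n) ->
        subgroups_of_index (braid_group n) k #= `I_1,
      k = n -> 6 < n ->
        subgroups_of_index (braid_group n) k #= `I_(n + 1)
    & k = 2 * n -> 6 < n ->
        subgroups_of_index (braid_group n) k #= `I_(3 * n + 1)].
Proof.
split=> [|->|->]; [exact: only_cyclic|exact: count_n|exact: count_2n].
Qed.
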